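(* Let $n\ge3$. For each $k=1,2,\dots,n-1$ let $$\tilde Z_k=\frac{1}{2n}\sum_{j=1}^{n-1}\sin\frac{kj\pi}{n}\,YX^{j-1}Z,$$ $$\tilde X_k=\frac{1}{2n}\Big(\sin\frac{k\pi}{n}\,X-\sum_{j=1}^{n-2}\big(\sin\frac{k(j+1)\pi}{n}\,YX^{j-1}Y-\sin\frac{kj\pi}{n}\,ZX^jZ\big)+\sin\frac{k(n-1)\pi}{n}\,X^{n-1}\Big),$$ $$\tilde Y_k=\frac{1}{2n}\Big(-\cos\frac{k\pi}{n}\,X+\cos (k\pi)\, YX^{n-2}Y+\cos\frac{k(n-1)\pi}{n}\,X^{n-1}+ZZ\Big)+\frac{1}{2n}\sum_{j=1}^{n-2}\Big(\cos\frac{k(j+1)\pi}{n}\,YX^{j-1}Y+\cos\frac{kj\pi}{n}\,ZX^jZ\Big).$$ Then $\{\tilde X_k,\tilde Y_k,\tilde Z_k:k=1,\dots,n-1\}$ is a canonical basis for the semisimple component $[\mathfrak{g}_{C_n},\mathfrak{g}_{C_n}]=\mathfrak{g}_1\oplus\cdots\oplus\mathfrak{g}_{n-1}$, where each $\mathfrak{g}_k\cong\mathfrak{su}(2)$.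
   Context: Qubits are indexed by $\mathbb{Z}_n=\{0,\dots,n-1\}$ with subscripts modulo $n$; $X_j,Y_j,Z_j$ are the Pauli matrices acting on qubit $j$. $\mathfrak{g}_{C_n}\subseteq\mathfrak{su}(2^n)$ is the real Lie algebra (bracket $[A,B]=AB-BA$) generated by $i\sum_jX_j$ and $i\sum_jZ_jZ_{j+1}$. It decomposes as the direct sum of its center and $n-1$ simple ideals $\mathfrak{g}_1,\dots,\mathfrak{g}_{n-1}$, each isomorphic to $\mathfrak{su}(2)$. The following are single symbols (not matrix products): $X=i\sum_{j\in\mathbb{Z}_n}X_j$; $X^{n-1}=i\sum_{j}X_jX_{j+1}\cdots X_{j+n-2}$; for $0\le t\le n-2$: $ZX^tZ=i\sum_jZ_jX_{j+1}\cdots X_{j+t}Z_{j+t+1}$, $YX^tY=i\sum_jY_jX_{j+1}\cdots X_{j+t}Y_{j+t+1}$, $YX^tZ=i\sum_j(Y_jX_{j+1}\cdots X_{j+t}Z_{j+t+1}+Z_jX_{j+1}\cdots X_{j+t}Y_{j+t+1})$; $ZZ=ZX^0Z$. Canonical basis: a basis $\bigcup_{k=1}^{n-1}\{\tilde X_k,\tilde Y_k,\tilde Z_k\}$ of $\mathfrak{g}_1\oplus\cdots\oplus\mathfrak{g}_{n-1}$ (each $\mathfrak{g}_k\cong\mathfrak{su}(2)$) is canonical if $[\tilde X_k,\tilde Y_k]=2\tilde Z_k$, $[\tilde Y_k,\tilde Z_k]=2\tilde X_k$, $[\tilde Z_k,\tilde X_k]=2\tilde Y_k$ for all $k$, and $[x,y]=0$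 whenever $x\in\{\tilde X_j,\tilde Y_j,\tilde Z_j\}$, $y\in\{\tilde X_k,\tilde Y_k,\tilde Z_k\}$ with $j\ne k$. *)

(* Defs.v *)
From HB Require Import structures.
From mathcomp Require Import all_boot all_order all_algebra.
From mathcomp Require Import mathcomp_extra boolp classical_sets functions.
From mathcomp Require Import reals trigo.
From mathcomp Require Import complex mxtens.

Set Implicit Arguments.
Unset Strict Implicit.
Unset Printing Implicit Defensive.

Import Order.TTheory GRing.Theory Num.Theory.

Local Open Scope classical_set_scope.
Local Open Scope ring_scope.
Local Open Scope complex_scope.
Local Open Scope sesquilinear_scope.

(* Real Lie algebras of complex matrices: sets of matrices in 'M[R[i]]_N, with
   scalars a : R acting through a%:C. *)

Definition real_subspace (R : realType) (N : nat) (V : set 'M[R[i]]_N) : Prop :=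
  V 0 /\ forall (a : R) A B, V A -> V B -> V (a%:C *: A + B).

Definition real_span (R : realType) (N : nat) (S : set 'M[R[i]]_N) :
  set 'M[R[i]]_N := smallest (@real_subspace R N) S.

Definition bracket (R : realType) (N : nat) (A B : 'M[R[i]]_N) : 'M[R[i]]_N :=
  A *m B - B *m A.

Definition lie_subalgebra (R : realType) (N : nat) (g : set 'M[R[i]]_N) : Prop :=
  real_subspace g /\ forall A B, g A -> g B -> g (bracket A B).

Definition lie_generated (R : realType) (N : nat) (S : set 'M[R[i]]_N) :
  set 'M[R[i]]_N := smallest (@lie_subalgebra R N) S.

Definition derived_algebra (R : realType) (N : nat) (g : set 'M[R[i]]_N) :
  set 'M[R[i]]_N := real_span [set bracket A B | A in g & B in g].

Definition lie_center (R : realType) (N : nat) (g : set 'M[R[i]]_N) :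
  set 'M[R[i]]_N := [set A | g A /\ forall B, g B -> bracket A B = 0].

Definition lie_ideal (R : realType) (N : nat) (h g : set 'M[R[i]]_N) : Prop :=
  [/\ real_subspace h, h `<=` g &
      forall A B, g A -> h B -> h (bracket A B)].

Definition simple_lie (R : realType) (N : nat) (g : set 'M[R[i]]_N) : Prop :=
  (exists A B, [/\ g A, g B & bracket A B <> 0]) /\
  forall h, lie_ideal h g -> h = [set 0] \/ h = g.

Definition lie_isomorphic (R : realType) (N M : nat)
    (g : set 'M[R[i]]_N) (h : set 'M[R[i]]_M) : Prop :=
  exists f : 'M[R[i]]_N -> 'M[R[i]]_M,
    [/\ forall (a : R) A B, g A -> g B -> f (a%:C *: A + B) = a%:C *: f A + f B,
        forall A B, g A -> g B -> f (bracket A B) = bracket (f A) (f B)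
      & set_bij g h f].

Definition su (R : realType) (N : nat) : set 'M[R[i]]_N :=
  [set A | A^t* = - A /\ \tr A = 0].
Arguments su : clear implicits.

Definition subspace_sum (R : realType) (N : nat) (I : finType)
    (U : I -> set 'M[R[i]]_N) : set 'M[R[i]]_N :=
  [set A | exists u : I -> 'M[R[i]]_N, (forall i, U i (u i)) /\ A = \sum_i u i].

Definition is_direct_sum (R : realType) (N : nat) (I : finType)
    (V : set 'M[R[i]]_N) (U : I -> set 'M[R[i]]_N) : Prop :=
  V = subspace_sum U /\
  forall u : I -> 'M[R[i]]_N, (forall i, U i (u i)) ->
    \sum_i u i = 0 -> forall i, u i = 0.

(* As a family, so that the vectors of a basis are in particular distinct. *)
Definition real_basis (R : realType) (N : nat) (I : finType)
    (V : set 'M[R[i]]_N) (e : I -> 'M[R[i]]_N) : Prop :=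
  V = [set A | exists c : I -> R, A = \sum_i (c i)%:C *: e i] /\
  forall c : I -> R, \sum_i (c i)%:C *: e i = 0 -> forall i, c i = 0.

Definition canonical_basis (R : realType) (N m : nat)
    (gk : 'I_m -> set 'M[R[i]]_N) (X Y Z : 'I_m -> 'M[R[i]]_N) : Prop :=
  [/\ real_basis (subspace_sum gk)
        (fun p : 'I_m * 'I_3 => [:: X p.1; Y p.1; Z p.1]`_(p.2)),
      forall k, [/\ bracket (X k) (Y k) = 2 *: Z k,
                    bracket (Y k) (Z k) = 2 *: X k
                  & bracket (Z k) (X k) = 2 *: Y k]
    & forall j k, j != k -> forall x y,
        [set X j; Y j; Z j] x -> [set X k; Y k; Z k] y -> bracket x y = 0].

Definition mx2 (R : realType) (a b c d : R[i]) : 'M[R[i]]_2 :=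
  \matrix_(r, s) nth 0 (nth [::] [:: [:: a; b]; [:: c; d]] r) s.

Definition sigmaX (R : realType) : 'M[R[i]]_2 := mx2 0 1 1 0.
Definition sigmaY (R : realType) : 'M[R[i]]_2 := mx2 0 (- 'i) 'i 0.
Definition sigmaZ (R : realType) : 'M[R[i]]_2 := mx2 1 0 0 (-1).

(* tensor A n is A 0 *t A 1 *t ... *t A n.-1; the recursion starts at n = 1
   because 2 ^ k.+2 is convertible to 2 * 2 ^ k.+1 but 2 ^ 1 is not to 2 * 2 ^ 0. *)
Fixpoint tensor_rec (R : realType) (A : nat -> 'M[R[i]]_2) (k : nat) :
    'M[R[i]]_(2 ^ k.+1) :=
  if k is k'.+1 then A 0%N *t tensor_rec (fun l => A l.+1) k' else A 0%N.

Definition tensor (R : realType) (A : nat -> 'M[R[i]]_2) (n : nat) :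
    'M[R[i]]_(2 ^ n) :=
  if n is k.+1 return 'M[R[i]]_(2 ^ n) then tensor_rec A k else 1%:M.

(* The operator P on qubit j, the subscript j being read modulo n. *)
Definition on_qubit (R : realType) (n : nat) (P : 'M[R[i]]_2) (j : nat) :
    'M[R[i]]_(2 ^ n) :=
  tensor (fun l => if l == (j %% n)%N then P else 1%:M) n.

Definition pX (R : realType) n j : 'M[R[i]]_(2 ^ n) := on_qubit n (sigmaX R) j.
Definition pY (R : realType) n j : 'M[R[i]]_(2 ^ n) := on_qubit n (sigmaY R) j.
Definition pZ (R : realType) n j : 'M[R[i]]_(2 ^ n) := on_qubit n (sigmaZ R) j.

(* X_(j+1) X_(j+2) ... X_(j+t) *)
Definition Xrun (R : realType) (n j t : nat) : 'M[R[i]]_(2 ^ n) :=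
  \big[mulmx/1%:M]_(1 <= l < t.+1) pX R n (j + l)%N.

Definition symX (R : realType) (n : nat) : 'M[R[i]]_(2 ^ n) :=
  'i *: \sum_(j < n) pX R n j.

(* X^{n-1} *)
Definition symXn1 (R : realType) (n : nat) : 'M[R[i]]_(2 ^ n) :=
  'i *: \sum_(j < n) \big[mulmx/1%:M]_(l < n.-1) pX R n (j + l)%N.

Definition symZXZ (R : realType) (n t : nat) : 'M[R[i]]_(2 ^ n) :=
  'i *: \sum_(j < n) (pZ R n j *m Xrun R n j t *m pZ R n (j + t + 1)%N).

Definition symYXY (R : realType) (n t : nat) : 'M[R[i]]_(2 ^ n) :=
  'i *: \sum_(j < n) (pY R n j *m Xrun R n j t *m pY R n (j + t + 1)%N).

Definition symYXZ (R : realType) (n t : nat) : 'M[R[i]]_(2 ^ n) :=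
  'i *: \sum_(j < n) (pY R n j *m Xrun R n j t *m pZ R n (j + t + 1)%N
                    + pZ R n j *m Xrun R n j t *m pY R n (j + t + 1)%N).

Definition gCn (R : realType) (n : nat) : set 'M[R[i]]_(2 ^ n) :=
  lie_generated
    [set symX R n; 'i *: \sum_(j < n) (pZ R n j *m pZ R n (j + 1)%N)].
Arguments gCn : clear implicits.

Definition sn (R : realType) (n k j : nat) : R[i] :=
  (sin (k%:R * j%:R * pi / n%:R : R))%:C.
Definition cs (R : realType) (n k j : nat) : R[i] :=
  (cos (k%:R * j%:R * pi / n%:R : R))%:C.

Definition tZ (R : realType) (n k : nat) : 'M[R[i]]_(2 ^ n) :=
  (2 * n%:R)^-1 *: \sum_(1 <= j < n) sn R n k j *: symYXZ R n j.-1.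

Definition tX (R : realType) (n k : nat) : 'M[R[i]]_(2 ^ n) :=
  (2 * n%:R)^-1 *:
    (sn R n k 1 *: symX R n
     - \sum_(1 <= j < n.-1) (sn R n k j.+1 *: symYXY R n j.-1
                             - sn R n k j *: symZXZ R n j)
     + sn R n k n.-1 *: symXn1 R n).

Definition tY (R : realType) (n k : nat) : 'M[R[i]]_(2 ^ n) :=
  (2 * n%:R)^-1 *:
    (- cs R n k 1 *: symX R n
     + (cos (k%:R * pi : R))%:C *: symYXY R n (n - 2)%N
     + cs R n k n.-1 *: symXn1 R n
     + symZXZ R n 0)
  + (2 * n%:R)^-1 *:
    \sum_(1 <= j < n.-1) (cs R n k j.+1 *: symYXY R n j.-1
                          + cs R n k j *: symZXZ R n j).

(* Main.v *)
Require Import Defs.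
From HB Require Import structures.
From mathcomp Require Import all_boot all_order all_algebra.
From mathcomp Require Import mathcomp_extra boolp classical_sets functions.
From mathcomp Require Import reals trigo.
From mathcomp Require Import complex mxtens.
From mathcomp Require Import ring lra.

Set Implicit Arguments.
Unset Strict Implicit.
Unset Printing Implicit Defensive.

Import Order.TTheory GRing.Theory Num.Theory.

Local Open Scope classical_set_scope.
Local Open Scope ring_scope.
Local Open Scope complex_scope.
Local Open Scope sesquilinear_scope.

(** Jordan-Wigner: let S_j = X_0 ... X_(j-1), a_j = S_j Z_j and b_j = S_j Y_j, for
    all natural j with the subscripts of X, Y, Z read modulo n. Going once around
    the cycle multiplies by the parity P = X_0 ... X_(n-1), which anticommutes
    with a_j and b_j, and going around twice is the identity, so the indices live
    in Z/2n. The sums A_t = -1/2 sum_j (b_j)^* a_(j+t) and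
    G_t = 1/2 sum_j ((a_j)^* a_(j+t) - (b_j)^* b_(j+t)) over Z/2n are, up to sign,
    the translation-invariant operators of the statement, and they satisfy the
    Onsager relations [A_s, A_t] = 2 G_(s-t) and
    [A_t, G_r] = 4 (A_(t+r) - A_(t-r)).

    With theta = k pi / n, the elements of the canonical basis are the Fourier modes
      X_k = 1/2n sum_t sin((t-1) theta) A_t,  Y_k = 1/2n sum_t cos((t-1) theta) A_t,
      Z_k = 1/4n sum_r sin(r theta) G_r,
    and the orthogonality of sines and cosines turns the Onsager relations into
    the commutation relations of n - 1 commuting copies of su(2). The modes k = 0
    and k = n are central, and Fourier inversion writes every A_t in terms of all
    the modes. Linear independence only needs that no Y_k vanishes, because
    brackets with X_k, Y_k, Z_k separate the coefficients. *)

(** * The Onsager relations *)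

(** Going around the cycle multiplies a Majorana operator by [P], so the usual route splits the
    space into the sectors P = 1 and P = -1, with a different boundary condition in each. The
    doubled cycle keeps both sectors in one computation: moving t by half a turn sends A_t to - P
    A_t, so [P] acts on the mode of frequency k as (-1)^(k+1); odd k live in the sector P = 1, even
    k in P = -1. This is why the frequencies are k pi / n and not 2 k pi / n. No dimension count or
    general structure theory enters: the generated algebra lies in the sum of the center and the
    copies of su(2) because that sum is a Lie subalgebra containing every A_t. The center itself is
    never computed, only shown to contain the two exceptional modes. The Onsager relations also hold
    for A = G = 0, so they cannot exclude a collapsed copy of su(2); hence the separate matrix-entry
    computation for Y_k. *)

(* [P] is the parity and [h] half a turn of the doubled cycle. [a] and [a'] list
   the same Majorana operators, lifted so that a half turn multiplies [a] by [P]
   on the left and [a'] by [P] on the right; then [a' j * a k] depends only on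
   the pair (j, k) modulo simultaneous half turns. Same for [b] and [b']. *)
Section Majorana.
Variables (I : finZmodType) (M : pzRingType) (a a' b b' : I -> M) (P : M) (h : I).
Hypothesis abE : forall j k, a k * b' j = - (b j * a' k).
Hypothesis abE' : forall j k, a' k * b j = - (b' j * a k).
Hypothesis aP : forall k, P * a k = a (k + h).
Hypothesis a'P : forall k, a' k * P = a' (k + h).
Hypothesis bP : forall k, P * b k = b (k + h).
Hypothesis b'P : forall k, b' k * P = b' (k + h).
Hypothesis aPN : forall k, a k * P = - (P * a k).
Hypothesis a'PN : forall k, P * a' k = - (a' k * P).
Hypothesis bPN : forall k, b k * P = - (P * b k).
Hypothesis b'PN : forall k, P * b' k = - (b' k * P).
Let delta (k l : I) : M := if k == l then 2 else 0.
Let deltaP (k l : I) : M := if k == l + h then 2 * P else 0.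
Hypothesis anti_a : forall k l, a k * a' l + a l * a' k =
  delta k l + deltaP k l.
Hypothesis anti_a' : forall k l, a' k * a l + a' l * a k =
  delta k l - deltaP k l.
Hypothesis anti_b : forall k l, b k * b' l + b l * b' k =
  delta k l + deltaP k l.
Hypothesis anti_b' : forall k l, b' k * b l + b' l * b k =
  delta k l - deltaP k l.
Hypothesis hh : h + h = 0.

(** In the notation of the overview this is -2 A_t, and [pair r] is 2 G_r; the halves wait until 2
    is invertible, since [M] is any ring. *)
Definition hop t := \sum_j b' j * a (j + t).
Definition pair r := \sum_j (a' j * a (j + r) - b' j * b (j + r)).

Lemma eq_half_shift k l : (k == l + h) = (l == k + h).
Proof. by apply/eqP/eqP=> ->; rewrite -addrA hh addr0. Qed.

Lemma sum_delta (F : I -> M) k :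
  \sum_l (delta k l + deltaP k l) * F l = 2 * F k + 2 * P * F (k + h).
Proof.
under eq_bigr do rewrite mulrDl.
rewrite big_split /=; congr (_ + _).
  rewrite (bigD1 k) //= /delta eqxx big1 ?addr0 // => l /negPf nl.
  by rewrite eq_sym nl mul0r.
rewrite (bigD1 (k + h)) //= /deltaP eq_half_shift eqxx big1 ?addr0 // => l /negPf nl.
by rewrite eq_half_shift nl mul0r.
Qed.

Lemma sum_delta_r (F : I -> M) k :
  \sum_l F l * (delta k l - deltaP k l) = F k * 2 - F (k + h) * (2 * P).
Proof.
under eq_bigr do rewrite mulrBr.
rewrite sumrB /=; congr (_ - _).
  rewrite (bigD1 k) //= /delta eqxx big1 ?addr0 // => l /negPf nl.
  by rewrite eq_sym nl mulr0.
rewrite (bigD1 (k + h)) //= /deltaP eq_half_shift eqxx big1 ?addr0 // => l /negPf nl.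
by rewrite eq_half_shift nl mulr0.
Qed.

Lemma sum_delta_l (F : I -> M) k :
  \sum_l (delta k l - deltaP k l) * F l = 2 * F k - 2 * P * F (k + h).
Proof.
under eq_bigr do rewrite mulrBl.
rewrite sumrB /=; congr (_ - _).
  rewrite (bigD1 k) //= /delta eqxx big1 ?addr0 // => l /negPf nl.
  by rewrite eq_sym nl mul0r.
rewrite (bigD1 (k + h)) //= /deltaP eq_half_shift eqxx big1 ?addr0 // => l /negPf nl.
by rewrite eq_half_shift nl mul0r.
Qed.

(** The terms l = k and l = k + h contribute equally, since the [P] of the second is absorbed by a
    half turn and h + h = 0; hence 4 where an ordinary cycle would give 2. *)
Lemma sum_anti_aa' k r : \sum_l (a k * a' l + a l * a' k) * a (l + r) = 4 * a (k + r).
Proof.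
under eq_bigr do rewrite anti_a.
by rewrite sum_delta /= -mulrA aP -!addrA (addrCA h) hh addr0 -mulrDl -natrD.
Qed.

Lemma natrM_comm (m : nat) (x : M) : x * m%:R = m%:R * x.
Proof. by rewrite mulr_natr mulr_natl. Qed.

Lemma sum_anti_a'a k r :
  \sum_l a l * (a' (l + r) * a k + a' k * a (l + r)) = 4 * a (k - r).
Proof.
rewrite (reindex_inj (addIr (- r))) /=.
under eq_bigr do rewrite subrK [X in _ * X]addrC anti_a'.
rewrite sum_delta_r /= (addrAC k h) mulrA !natrM_comm -mulrA aPN -aP mulrN opprK.
by rewrite aP aP -addrA hh addr0 -mulrDl -natrD.
Qed.

Lemma sum_anti_b'b k r :
  \sum_l (b' k * b l + b' l * b k) * b' (l + r) = 4 * b' (k + r).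
Proof.
under eq_bigr do rewrite anti_b'.
rewrite sum_delta_l /= -mulrA b'PN mulrN opprK b'P.
by rewrite -!addrA (addrCA h) hh addr0 -mulrDl -natrD.
Qed.

Lemma sum_anti_bb' k r :
  \sum_l b' l * (b (l + r) * b' k + b k * b' (l + r)) = 4 * b' (k - r).
Proof.
rewrite (reindex_inj (addIr (- r))) /=.
under eq_bigr do rewrite subrK [X in _ * X]addrC anti_b.
rewrite (eq_bigr (fun l => b' (l - r) * (delta k l - - deltaP k l))); last first.
  by move=> l _; rewrite opprK.
rewrite (_ : \sum_i _ = b' (k - r) * 2 + b' (k + h - r) * (2 * P)).
  rewrite (addrAC k h) mulrA !natrM_comm -mulrA b'P.
  by rewrite -!addrA hh addr0 -mulrDl -natrD.
under eq_bigr do rewrite opprK mulrDr.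
rewrite big_split /=; congr (_ + _).
  rewrite (bigD1 k) //= /delta eqxx big1 ?addr0 // => l /negPf nl.
  by rewrite eq_sym nl mulr0.
rewrite (bigD1 (k + h)) //= /deltaP eq_half_shift eqxx big1 ?addr0 // => l /negPf nl.
by rewrite eq_half_shift nl mulr0.
Qed.

(** [b' j] passes two [a]s at the cost of two signs, each passage swapping the primes; what is left
    of the commutator is a difference of anticommutators, which [anti_a] and [anti_a'] evaluate. *)
Lemma hop_pair j k l m : b' j * a k * (a' l * a m) - a' l * a m * (b' j * a k) =
  b' j * ((a k * a' l + a l * a' k) * a m - a l * (a' m * a k + a' k * a m)).
Proof.
have -> : a' l * a m * (b' j * a k) = b' j * a l * a' m * a k.
  by rewrite mulrA -(mulrA (a' l)) abE mulrN mulrA abE' !mulNr opprK.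
by rewrite mulrBr mulrDl !mulrDr !mulrA opprD addrACA subrr addr0.
Qed.

Lemma hop_pair' j k l m : b' j * a k * (b' l * b m) - b' l * b m * (b' j * a k) =
  ((b' j * b l + b' l * b j) * b' m - b' l * (b m * b' j + b j * b' m)) * a k.
Proof.
have -> : b' j * a k * (b' l * b m) = b' j * b l * b' m * a k.
  rewrite mulrA -(mulrA (b' j)) abE mulrN mulNr -(mulrA (b' j)) -(mulrA (b l)) abE'.
  by rewrite !mulrN opprK !mulrA.
by rewrite mulrBl !mulrDl !mulrDr mulrDl !mulrA opprD addrACA subrr addr0.
Qed.

Lemma hop_hop j k l m : b' j * a k * (b' l * a m) - b' l * a m * (b' j * a k) =
  (b' j * b l + b' l * b j) * (a' m * a k)
  - b' j * b l * (a' m * a k + a' k * a m).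
Proof.
have E p q r s : b' p * a q * (b' r * a s) = - (b' p * b r * (a' q * a s)).
  by rewrite mulrA -(mulrA (b' p)) abE mulrN mulNr !mulrA.
by rewrite !E mulrDl mulrDr opprK opprD addrACA subrr add0r addrC.
Qed.

Lemma comm_hop_pair t r :
  hop t * pair r - pair r * hop t = 8 * (hop (t + r) - hop (t - r)).
Proof.
have -> : hop t * pair r - pair r * hop t =
  \sum_j (\sum_l (b' j * a (j + t) * (a' l * a (l + r)) - a' l * a (l + r) * (b' j * a (j + t)))
   - \sum_l (b' j * a (j + t) * (b' l * b (l + r)) - b' l * b (l + r) * (b' j * a (j + t)))).
  rewrite /hop mulr_suml mulr_sumr -sumrB; apply: eq_bigr => j _.
  rewrite /pair mulr_sumr mulr_suml -!sumrB; apply: eq_bigr => l _.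
  by rewrite mulrBr mulrBl !opprD !opprK addrACA.
transitivity (\sum_j 4 * ((b' j * a (j + (t + r)) - b' j * a (j + (t - r)))
   - (b' (j + r) * a (j + t) - b' (j - r) * a (j + t)))); last first.
  rewrite -mulr_sumr !sumrB.
  rewrite -/(hop (t + r)) -/(hop (t - r)).
  (* By translation the [b] half of [pair] yields the same two hops as the [a] half, which doubles 4
     to 8. *)
  have -> : \sum_i b' (i + r) * a (i + t) = hop (t - r).
    rewrite /hop [RHS](reindex_inj (addIr r)) /=; apply: eq_bigr => j _.
    by rewrite addrA (addrAC j r t) addrK.
  have -> : \sum_i b' (i - r) * a (i + t) = hop (t + r).
    rewrite /hop [RHS](reindex_inj (addIr (- r))) /=; apply: eq_bigr => j _.
    by rewrite addrA (addrAC j _ t) subrK.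
  by rewrite opprB -mulr2n -[X in _ * X]mulr_natl mulrA -natrM.
apply: eq_bigr => j _; rewrite mulrBr; congr (_ - _).
  under eq_bigr do rewrite hop_pair.
  by rewrite -mulr_sumr sumrB sum_anti_aa' sum_anti_a'a !mulrBr !mulrA natrM_comm !addrA.
under eq_bigr do rewrite hop_pair'.
by rewrite -mulr_suml sumrB sum_anti_b'b sum_anti_bb' !mulrBr mulrBl !mulrA.
Qed.

Lemma comm_hop_hop s t :
  hop s * hop t - hop t * hop s = 4 * pair (s - t).
Proof.
have -> : hop s * hop t - hop t * hop s =
  \sum_j \sum_l (b' j * a (j + s) * (b' l * a (l + t)) - b' l * a (l + t) * (b' j * a (j + s))).
  rewrite /hop mulr_suml mulr_sumr -sumrB; apply: eq_bigr => j _.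
  by rewrite mulr_sumr mulr_suml -!sumrB.
transitivity (\sum_j 4 * (a' (j + t) * a (j + s) - b' j * b (j + (s - t)))); last first.
  rewrite /pair -mulr_sumr !sumrB; congr (_ * (_ - _)).
  rewrite [LHS](reindex_inj (addIr (- t))); apply: eq_bigr => j _ /=.
  by rewrite subrK addrAC addrA.
apply: eq_bigr => j _.
under eq_bigr do rewrite hop_hop.
rewrite sumrB mulrBr; congr (_ - _).
  under eq_bigr do rewrite anti_b'.
  rewrite sum_delta_l /= (addrAC j h t) -mulrA (mulrA P) a'PN mulNr mulrN opprK.
  by rewrite a'P -!addrA hh addr0 -mulrDl -natrD.
rewrite (reindex_inj (addIr (- t))) /=.
under eq_bigr do rewrite subrK [X in _ * X]addrC anti_a'.
rewrite sum_delta_r /= (addrAC (j + s) h) !mulrA !natrM_comm -!mulrA bPN !mulrN opprK bP.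
by rewrite -!addrA hh addr0 -mulrDl -natrD.
Qed.

(** Swapping the two factors costs an anticommutator; [anti_a'] and [anti_b'] have the same
    right-hand side, so it cancels in the difference defining [pair]. *)
Lemma pairN r : pair (- r) = - pair r.
Proof.
rewrite /pair (reindex_inj (addIr r)) /= -sumrN; apply: eq_bigr => j _.
have Ea : a' (j + r) * a j = delta (j + r) j - deltaP (j + r) j - a' j * a (j + r).
  by rewrite -anti_a' addrK.
have Eb : b' (j + r) * b j = delta (j + r) j - deltaP (j + r) j - b' j * b (j + r).
  by rewrite -anti_b' addrK.
rewrite addrK Ea Eb; move: (_ - deltaP _ _) => D.
by rewrite !opprB addrC addrA subrK.
Qed.

End Majorana.

(** * Jordan-Wigner operators on the doubled cycle *)

Section JordanWigner.
Variables (M : pzRingType) (n : nat) (X : nat -> M).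
Hypothesis XX : forall j, X j * X j = 1.
Hypothesis XC : forall j k, X j * X k = X k * X j.
Hypothesis Xn : forall j, X (j + n)%N = X j.

Definition jw_string j := \prod_(l < j) X l.
Definition parity := jw_string n.

Lemma jw_stringS j : jw_string j.+1 = jw_string j * X j.
Proof. by rewrite /jw_string big_ord_recr. Qed.

Lemma X_jw j k : X k * jw_string j = jw_string j * X k.
Proof.
elim: j => [|j IH]; first by rewrite /jw_string big_ord0 mulr1 mul1r.
by rewrite jw_stringS mulrA IH -!mulrA XC.
Qed.

Lemma jw_jw j k : jw_string j * jw_string k = jw_string k * jw_string j.
Proof.
elim: j => [|j IH]; first by rewrite /jw_string big_ord0 mulr1 mul1r.
by rewrite jw_stringS -mulrA X_jw mulrA IH mulrA.
Qed.

Lemma jw_sqr j : jw_string j * jw_string j = 1.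
Proof.
elim: j => [|j IH]; first by rewrite /jw_string big_ord0 mulr1.
by rewrite jw_stringS -mulrA (mulrA (X j)) X_jw !mulrA IH mul1r XX.
Qed.

Lemma jw_stringD j t : jw_string (j + t) = jw_string j * \prod_(l < t) X (j + l)%N.
Proof.
elim: t => [|t IH]; first by rewrite addn0 big_ord0 mulr1.
by rewrite addnS jw_stringS IH big_ord_recr /= mulrA.
Qed.

Lemma jw_stringDn j : jw_string (j + n) = parity * jw_string j.
Proof.
elim: j => [|j IH]; first by rewrite /jw_string add0n big_ord0 mulr1.
by rewrite addSn !jw_stringS IH Xn mulrA.
Qed.

(* What [Z] and [Y] have in common. *)
Definition anti_local (T : nat -> M) :=
  [/\ forall j, T j * T j = 1, forall j, T (j + n)%N = T j,
      forall j k, T j * T k = T k * T j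
    & forall j k, (j < n)%N -> (k < n)%N ->
      T j * X k = (if j == k then - (X k * T j) else X k * T j)].

Section One.
Variable T : nat -> M.
Hypothesis HT : anti_local T.

(* The strings run over all of nat, so that [jw (j + n) = parity * jw j] and
   [jw] is [2n]-periodic; [jw'] has the factors in the opposite order. *)
Definition jw j := jw_string j * T j.
Definition jw' j := T j * jw_string j.

Lemma local_jw j k : (j < n)%N -> (k <= n)%N ->
  T j * jw_string k = if (j < k)%N then - (jw_string k * T j) else jw_string k * T j.
Proof.
case: HT => _ _ _ TX jn.
elim: k => [|k IH] kn; first by rewrite /jw_string big_ord0 mulr1 mul1r.
rewrite jw_stringS mulrA (IH (ltnW kn)) ltnS.
case: ltngtP => jk; rewrite ?mulNr -mulrA TX //.
- by rewrite ltn_eqF // mulrA.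
- by rewrite gtn_eqF // mulrA.
- by rewrite jk eqxx mulrN mulrA.
Qed.

Lemma jw'E j : (j < n)%N -> jw' j = jw j.
Proof. by move=> jn; rewrite /jw' local_jw ?ltnn // ltnW. Qed.

Lemma jw_addn j : jw (j + n) = parity * jw j.
Proof. by case: HT => _ Tn _ _; rewrite /jw jw_stringDn Tn mulrA. Qed.

Lemma jw'_addn j : jw' (j + n) = jw' j * parity.
Proof. by case: HT => _ Tn _ _; rewrite /jw' jw_stringDn Tn jw_jw mulrA. Qed.

Lemma jw_addnn j : jw (j + n + n) = jw j.
Proof. by rewrite !jw_addn mulrA jw_sqr mul1r. Qed.

Lemma jw'_addnn j : jw' (j + n + n) = jw' j.
Proof. by rewrite !jw'_addn -mulrA jw_sqr mulr1. Qed.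

Lemma jw_modn j : jw (j %% n.*2) = jw j.
Proof.
rewrite {2}(divn_eq j n.*2); elim: (j %/ n.*2)%N => [//|q ->].
by rewrite [in RHS]mulSn -addnA [in RHS]addnC -addnn [in RHS]addnA jw_addnn.
Qed.

Lemma jw'_modn j : jw' (j %% n.*2) = jw' j.
Proof.
rewrite {2}(divn_eq j n.*2); elim: (j %/ n.*2)%N => [//|q ->].
by rewrite [in RHS]mulSn -addnA [in RHS]addnC -addnn [in RHS]addnA jw'_addnn.
Qed.

Lemma jw_parity_lt j : (j < n)%N -> jw j * parity = - (parity * jw j).
Proof.
by move=> jn; rewrite /jw -mulrA local_jw // jn mulrN !mulrA (jw_jw j).
Qed.
End One.

Lemma jw_diag T U k : anti_local T -> (k < n)%N -> jw T k * jw U k = T k * U k.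
Proof.
by move=> HT kn; rewrite -(jw'E HT) // /jw' /jw -mulrA (mulrA (jw_string k)) jw_sqr mul1r.
Qed.

Section Two.
Variables T U : nat -> M.
Hypotheses (HT : anti_local T) (HU : anti_local U).
Hypothesis TU : forall j k, (j < n)%N -> (k < n)%N -> j != k -> T j * U k = U k * T j.

(** The single sign arises at site j: [T j] crosses the longer string of [U k], which contains
    [X j], while [U k] commutes with the shorter string. *)
Lemma jw_anti j k : (j < k < n)%N -> jw T j * jw U k = - (jw U k * jw T j).
Proof.
move=> /andP[jk kn]; have jn := ltn_trans jk kn.
rewrite /jw -mulrA (mulrA (T j)) (local_jw HT jn (ltnW kn)) jk mulNr mulrN.
rewrite -[in RHS]mulrA (mulrA (U k)) (local_jw HU kn (ltnW jn)) ltnNge (ltnW jk) /=.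
by rewrite !mulrA jw_jw -!mulrA TU // ltn_eqF.
Qed.
End Two.

Lemma jw_anti_same T j k : anti_local T -> (j < n)%N -> (k < n)%N ->
  jw T j * jw T k + jw T k * jw T j = if j == k then 2 else 0.
Proof.
move=> HT jn kn; have [TT _ TC _] := HT.
have CC a b : (a < n)%N -> (b < n)%N -> a != b -> T a * T b = T b * T a by move=> *; rewrite TC.
case: (ltngtP j k) => [jk|kj|->].
- by rewrite (jw_anti HT HT CC) ?jk // addNr.
- by rewrite (jw_anti HT HT CC _ (j := k)) ?kj // addrN.
- by rewrite (jw_diag _ HT) // TT.
Qed.

Lemma jw_anti_cross T U j k : anti_local T -> anti_local U ->
  (forall j k, (j < n)%N -> (k < n)%N ->
     T j * U k = if j == k then - (U k * T j) else U k * T j) ->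
  (j < n)%N -> (k < n)%N -> jw T j * jw U k = - (jw U k * jw T j).
Proof.
move=> HT HU TU jn kn.
case: (ltngtP j k) => [jk|kj|->].
- by apply: (jw_anti HT HU) => [a b an bn /negPf ab|]; rewrite ?jk // TU // ab.
- rewrite (jw_anti HU HT) ?kj ?opprK // => a b an bn ab.
  by rewrite TU // eq_sym (negPf ab).
- by rewrite (jw_diag _ HT) // (jw_diag _ HU) // TU // eqxx.
Qed.

End JordanWigner.

Section DoubleCover.
Variable n : nat.
Hypothesis n_gt0 : (0 < n)%N.
Notation I := 'Z_(n.*2).
Definition half : I := n%:R.

Let n2_gt1 : (1 < n.*2)%N. Proof. by rewrite -addnn -(addn1 1) leq_add. Qed.

Lemma double_n_eq0 : n.*2%:R = 0 :> I.
Proof. by rewrite pchar_Zp. Qed.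

Lemma half_half : half + half = 0.
Proof. by rewrite /half -natrD addnn double_n_eq0. Qed.

Lemma natZ_eq k l : (k < n.*2)%N -> (l < n.*2)%N -> (k%:R == l%:R :> I) = (k == l).
Proof. by move=> kn ln; rewrite -val_eqE /= !val_Zp_nat // !modn_small. Qed.

Lemma natZ_half_eq k l : (k < n)%N -> (l < n)%N -> (k%:R == l%:R + half :> I) = false.
Proof.
move=> kn ln; rewrite /half -natrD natZ_eq -?addnn ?ltn_add2r //; last first.
  exact: ltn_addr.
by rewrite ltn_eqF // ltn_addl.
Qed.

Lemma half_split (x : I) : exists2 k, (k < n)%N & x = k%:R \/ x = k%:R + half.
Proof.
have xE : x = (x : nat)%:R by rewrite natr_Zp.
have xlt : (x < n.*2)%N by rewrite -{2}(Zp_cast n2_gt1) ltn_ord.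
have [xn|nx] := ltnP x n; first by exists (x : nat); [|left].
exists (x - n)%N; first by rewrite ltn_subLR // addnn.
by right; rewrite /half -natrD subnK.
Qed.

Section Instance.
Variables (M : pzRingType) (X Y Z : nat -> M).
Hypothesis XX : forall j, X j * X j = 1.
Hypothesis XC : forall j k, X j * X k = X k * X j.
Hypothesis Xn : forall j, X (j + n)%N = X j.
Hypothesis HZ : anti_local n X Z.
Hypothesis HY : anti_local n X Y.
Hypothesis ZY : forall j k, (j < n)%N -> (k < n)%N ->
  Z j * Y k = if j == k then - (Y k * Z j) else Y k * Z j.

Local Notation P := (parity n X).

Definition maj T (x : I) := jw X T x.
Definition maj' T (x : I) := jw' X T x.

Section OneT.
Variable T : nat -> M.
Hypothesis HT : anti_local n X T.

Lemma majE k : maj T k%:R = jw X T k.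
Proof. by rewrite /maj val_Zp_nat // (jw_modn XX XC Xn HT). Qed.

Lemma maj'E k : maj' T k%:R = jw' X T k.
Proof. by rewrite /maj' val_Zp_nat // (jw'_modn XX XC Xn HT). Qed.

Lemma maj_half x : P * maj T x = maj T (x + half).
Proof. by rewrite -(natr_Zp x) /half -natrD !majE (jw_addn Xn HT). Qed.

Lemma maj'_half x : maj' T x * P = maj' T (x + half).
Proof. by rewrite -(natr_Zp x) /half -natrD !maj'E (jw'_addn XC Xn HT). Qed.

Lemma maj_parity x : maj T x * P = - (P * maj T x).
Proof.
have [k kn xE] := half_split x.
have H := jw_parity_lt XC HT kn.
case: xE => ->; first by rewrite majE H.
by rewrite -maj_half majE -mulrA H mulrN.
Qed.

Lemma maj'_parity x : P * maj' T x = - (maj' T x * P).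
Proof.
have [k kn xE] := half_split x.
have H := jw_parity_lt XC HT kn; rewrite -(jw'E HT kn) in H.
have H' : P * jw' X T k = - (jw' X T k * P) by rewrite H opprK.
case: xE => ->; first by rewrite maj'E H'.
by rewrite -maj'_half maj'E mulrA H' mulNr.
Qed.

Lemma maj_addE k : maj T (k%:R + half) = P * jw X T k.
Proof. by rewrite -maj_half majE. Qed.

Lemma maj'_addE k : (k < n)%N -> maj' T (k%:R + half) = jw X T k * P.
Proof. by move=> kn; rewrite -maj'_half maj'E (jw'E HT). Qed.

Lemma maj'_ltE k : (k < n)%N -> maj' T k%:R = jw X T k.
Proof. by move=> kn; rewrite maj'E (jw'E HT). Qed.

Let PP : P * P = 1. Proof. exact: (jw_sqr XX XC). Qed.

(** [maj] carries its [P] on the left and [maj'] on the right, so a lone [P] crosses zero or two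
    Majorana operators and comes out in front without sign; two of them cancel. *)
Lemma maj_anti x y : maj T x * maj' T y + maj T y * maj' T x =
  (if x == y then 2 else 0) + (if x == y + half then 2 * P else 0).
Proof.
have [k kn xE] := half_split x; have [l ln yE] := half_split y.
have A := jw_anti_same XX XC HT kn ln.
set d := (if _ then _ else _) in A.
have Pd : (if k == l then 2 * P else 0) = P * d.
  by rewrite /d; case: eqP; rewrite ?mulr0 // mulr_natl mulr_natr.
have k2 : (k < n.*2)%N by rewrite -addnn ltn_addr.
have l2 : (l < n.*2)%N by rewrite -addnn ltn_addr.
have comm u v : (u < n)%N -> (v < n)%N ->
    jw X T u * jw X T v * P = P * (jw X T u * jw X T v).
  move=> un vn; rewrite -mulrA (jw_parity_lt XC HT vn) mulrN mulrA.
  by rewrite (jw_parity_lt XC HT un) mulNr opprK mulrA.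
case: xE => ->; case: yE => ->; rewrite ?maj_addE ?majE ?maj'_addE ?maj'_ltE //.
- by rewrite A natZ_eq // natZ_half_eq // addr0.
- rewrite natZ_half_eq // -[_ + half + half]addrA half_half addr0 natZ_eq //.
  by rewrite add0r Pd mulrA comm // -mulrA -mulrDr A.
- rewrite eq_sym natZ_half_eq // add0r (inj_eq (addIr _)) natZ_eq // Pd.
  by rewrite [X in _ + X]mulrA comm // -mulrA -mulrDr A.
- rewrite (inj_eq (addIr _)) natZ_eq // -[_ + half + half]addrA half_half addr0.
  rewrite [_ == l%:R]eq_sym natZ_half_eq // addr0 -/d -A.
  have E u v : (u < n)%N -> (v < n)%N ->
      P * jw X T u * (jw X T v * P) = jw X T u * jw X T v.
    move=> un vn; rewrite mulrA -(mulrA P) -(mulrA P (_ * _)) comm //.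
    by rewrite mulrA PP mul1r.
  by rewrite !E.
Qed.

(** Here a lone [P] stands between the two Majorana operators and crosses one of them to come out in
    front: this is the minus sign, opposite to [maj_anti]. *)
Lemma maj'_anti x y : maj' T x * maj T y + maj' T y * maj T x =
  (if x == y then 2 else 0) - (if x == y + half then 2 * P else 0).
Proof.
have [k kn xE] := half_split x; have [l ln yE] := half_split y.
have Hk := jw_parity_lt XC HT kn; have Hl := jw_parity_lt XC HT ln.
have A := jw_anti_same XX XC HT kn ln.
set d := (if _ then _ else _) in A.
have Pd : (if k == l then 2 * P else 0) = P * d.
  by rewrite /d; case: eqP; rewrite ?mulr0 // mulr_natl mulr_natr.
have k2 : (k < n.*2)%N by rewrite -addnn ltn_addr.
have l2 : (l < n.*2)%N by rewrite -addnn ltn_addr.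
case: xE => ->; case: yE => ->; rewrite ?maj_addE ?majE ?maj'_addE ?maj'_ltE //;
  move: (jw X T k) (jw X T l) A Hk Hl => u v A Hk Hl.
- by rewrite A natZ_eq // natZ_half_eq // subr0.
- rewrite natZ_half_eq // -[_ + half + half]addrA half_half addr0 natZ_eq //.
  by rewrite sub0r Pd !mulrA Hk Hl !mulNr -opprD -!mulrA -mulrDr A.
- rewrite eq_sym natZ_half_eq // sub0r (inj_eq (addIr _)) natZ_eq // Pd.
  by rewrite !mulrA Hk Hl !mulNr -opprD -!mulrA -mulrDr A.
- rewrite (inj_eq (addIr _)) natZ_eq // -[_ + half + half]addrA half_half addr0.
  rewrite [_ == l%:R]eq_sym natZ_half_eq // subr0 -/d -A.
  by rewrite !mulrA -(mulrA u P P) -(mulrA v P P) PP !mulr1.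
Qed.
End OneT.

Lemma maj_cross T U j k : anti_local n X T -> anti_local n X U ->
  (forall j k, (j < n)%N -> (k < n)%N ->
     T j * U k = if j == k then - (U k * T j) else U k * T j) ->
  maj T k * maj' U j = - (maj U j * maj' T k) /\
  maj' T k * maj U j = - (maj' U j * maj T k).
Proof.
move=> HT HU TU.
have [l ln kE] := half_split k; have [m mn jE] := half_split j.
have E := jw_anti_cross XX XC HT HU TU ln mn.
have Hl := jw_parity_lt XC HT ln; have Hm := jw_parity_lt XC HU mn.
have PP : P * P = 1 by exact: (jw_sqr XX XC).
(* In each of the four cases words are normalised by moving every [P] to the left with its sign,
   cancelling P P, and exchanging u and v. *)
by case: kE => ->; case: jE => ->;
  rewrite ?(maj_addE HT) ?(maj_addE HU) ?(majE HT) ?(majE HU)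
    ?(maj'_addE HT) ?(maj'_addE HU) ?(maj'_ltE HT) ?(maj'_ltE HU) //;
  move: (jw X T l) (jw X U m) E Hl Hm => u v E Hl Hm; split;
  rewrite !mulrA ?[_ * P]Hl ?[_ * P]Hm ?mulNr;
  do ?[rewrite -(mulrA _ u v) E | rewrite -(mulrA _ u P) Hl | rewrite -(mulrA _ v P) Hm |
       rewrite E | rewrite Hl | rewrite Hm |
       rewrite mulrN | rewrite mulNr | rewrite opprK | rewrite mulrA | rewrite PP | rewrite mul1r].
Qed.

Definition hopZY := hop (maj Z) (maj' Y).
Definition pairZY := pair (maj Z) (maj' Z) (maj Y) (maj' Y).

Ltac majorana := apply; try first [ exact: half_half
  | exact: maj_half HZ | exact: maj_half HY | exact: maj'_half HZ | exact: maj'_half HY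
  | exact: maj_parity HZ | exact: maj_parity HY
  | exact: maj'_parity HZ | exact: maj'_parity HY
  | exact: maj_anti HZ | exact: maj_anti HY | exact: maj'_anti HZ | exact: maj'_anti HY
  | by move=> j k; have [] := maj_cross j k HZ HY ZY ].

Lemma comm_hop_hopZY s t :
  hopZY s * hopZY t - hopZY t * hopZY s = 4 * pairZY (s - t).
Proof. by move: (@comm_hop_hop _ _ (maj Z) (maj' Z) (maj Y) (maj' Y) P half); majorana. Qed.

Lemma comm_hop_pairZY t r :
  hopZY t * pairZY r - pairZY r * hopZY t = 8 * (hopZY (t + r) - hopZY (t - r)).
Proof. by move: (@comm_hop_pair _ _ (maj Z) (maj' Z) (maj Y) (maj' Y) P half); majorana. Qed.

Lemma pairZYN r : pairZY (- r) = - pairZY r.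
Proof. by move: (@pairN _ _ (maj Z) (maj' Z) (maj Y) (maj' Y) P half); majorana. Qed.
End Instance.
End DoubleCover.

(** * Pauli operators *)

Section Tensor.
Variable R : realType.
Local Notation C := R[i].
Implicit Types (A B : nat -> 'M[C]_2) (P Q : 'M[C]_2).

Lemma tensorM A B n : tensor A n *m tensor B n = tensor (fun l => A l *m B l) n.
Proof.
case: n => [|n]; first by rewrite mulmx1.
rewrite /=; elim: n A B => [//|n IH] A B /=.
by rewrite tensmx_mul IH.
Qed.

Lemma eq_tensor A B n : (forall l, (l < n)%N -> A l = B l) -> tensor A n = tensor B n.
Proof.
case: n => [//|n] /=; elim: n A B => [|n IH] A B AB /=; first exact: AB.
by rewrite AB //; congr (_ *t _); apply: IH => l ln; apply: AB.
Qed.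

Lemma tens1mx1 p q : (1%:M : 'M[C]_p) *t (1%:M : 'M[C]_q) = 1%:M.
Proof.
apply/matrixP=> i j; case: (mxtens_indexP i) => a b; case: (mxtens_indexP j) => c d.
rewrite tensmxE !mxE -natrM mulnb (inj_eq (can_inj (@mxtens_indexK _ _))).
by rewrite xpair_eqE.
Qed.

Lemma tensor1 n : tensor (fun=> 1%:M : 'M[C]_2) n = 1%:M.
Proof.
case: n => [//|n] /=; elim: n => [//|n /= ->].
exact: tens1mx1.
Qed.

Lemma tensorZ A c j n : (j < n)%N ->
  tensor (fun l => if l == j then c *: A l else A l) n = c *: tensor A n.
Proof.
case: n => [//|n] /=; elim: n A j => [|n IH] A j /= jn; first by case: j jn.
case: j jn => [|j] jn /=.
  by apply/matrixP=> i k; rewrite !mxE mulrA.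
have -> : tensor_rec (fun l => if l.+1 == j.+1 then c *: A l.+1 else A l.+1) n
   = c *: tensor_rec (fun l => A l.+1) n by rewrite -(IH _ j).
by apply/matrixP=> i k; rewrite !mxE mulrCA.
Qed.

(** [i0] indexes the n-fold tensor power of the first basis vector of a qubit; its row and its
    column are both needed because [Z j] will be multiplied on either side. *)
Lemma tensor_basis0 n : exists i0 : 'I_(2 ^ n), forall A,
  ((forall l c, A l 0 c = (c == 0)%:R) -> forall c, tensor A n i0 c = (c == i0)%:R) /\
  ((forall l c, A l c 0 = (c == 0)%:R) -> forall c, tensor A n c i0 = (c == i0)%:R).
Proof.
case: n => [|n] /=.
  by exists ord0 => A; split=> _ c; rewrite mxE // eq_sym.
elim: n => [|n [i0 IH]] /=; first by exists 0 => A; split=> HA c; exact: HA.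
exists (mxtens_index (0 : 'I_2, i0)) => A.
have [IHr IHc] := IH (fun l => A l.+1).
have E (j : 'I_2) k : ((j == 0%R) * (k == i0))%N%:R =
    (mxtens_index (j, k) == mxtens_index (0 : 'I_2, i0))%:R :> C.
  by rewrite mulnb (inj_eq (can_inj (@mxtens_indexK _ _))) xpair_eqE.
split=> HA c; case: (mxtens_indexP c) => j k; rewrite tensmxE HA ?IHr ?IHc // -natrM; exact: E.
Qed.

Section Qubit.
Variable n : nat.
Hypothesis n_gt0 : (0 < n)%N.

Lemma on_qubitM P Q j : on_qubit n P j *m on_qubit n Q j = on_qubit n (P *m Q) j.
Proof. by rewrite tensorM; apply: eq_tensor => l _; case: eqP; rewrite ?mulmx1. Qed.

Lemma on_qubit1 j : on_qubit n (1%:M : 'M[C]_2) j = 1%:M.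
Proof. by rewrite -[RHS]tensor1; apply: eq_tensor => l _; case: eqP. Qed.

Lemma on_qubitZ c P j : on_qubit n (c *: P) j = c *: on_qubit n P j.
Proof.
rewrite -(@tensorZ _ _ (j %% n)%N) ?ltn_pmod //.
by apply: eq_tensor => l _; case: eqP.
Qed.

Lemma on_qubit_comm P Q j k : (j %% n != k %% n)%N ->
  on_qubit n P j *m on_qubit n Q k = on_qubit n Q k *m on_qubit n P j.
Proof.
move=> jk; rewrite !tensorM; apply: eq_tensor => l _.
case: eqP => [->|]; last by rewrite mul1mx mulmx1.
by rewrite (negPf jk) mul1mx mulmx1.
Qed.

Lemma on_qubit_mod P j : on_qubit n P (j %% n) = on_qubit n P j.
Proof. by rewrite /on_qubit modn_mod. Qed.

Lemma on_qubit_addn P j : on_qubit n P (j + n) = on_qubit n P j.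
Proof. by rewrite -on_qubit_mod modnDr on_qubit_mod. Qed.

End Qubit.
End Tensor.

Section Pauli.
Variable R : realType.
Local Notation C := R[i].

Lemma mx2M (a b c d a1 b1 c1 d1 : C) : mx2 a b c d *m mx2 a1 b1 c1 d1 =
  mx2 (a * a1 + b * c1) (a * b1 + b * d1) (c * a1 + d * c1) (c * b1 + d * d1).
Proof.
apply/matrixP=> i j; rewrite !mxE !big_ord_recl big_ord0 !mxE /= addr0.
by case: i => -[|[|//]] ?; case: j => -[|[|//]] ?.
Qed.

Lemma mx2Z (x a b c d : C) : x *: mx2 a b c d = mx2 (x * a) (x * b) (x * c) (x * d).
Proof.
by apply/matrixP=> i j; rewrite !mxE; case: i => -[|[|//]] ?; case: j => -[|[|//]] ?.
Qed.

Lemma mx2_1 : (1%:M : 'M[C]_2) = mx2 1 0 0 1.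
Proof.
by apply/matrixP=> i j; rewrite !mxE; case: i => -[|[|//]] ?; case: j => -[|[|//]] ?.
Qed.

Local Notation I := (Num.imaginary : C).

Let II : I * I = -1.
Proof. by rewrite -expr2 sqrCi. Qed.

Ltac pauli := rewrite /sigmaX /sigmaY /sigmaZ ?complexiE ?mx2M ?mx2_1 ?mx2Z; congr mx2; ring: II.

Lemma sigmaXX : sigmaX R *m sigmaX R = 1%:M. Proof. by pauli. Qed.
Lemma sigmaYY : sigmaY R *m sigmaY R = 1%:M. Proof. by pauli. Qed.
Lemma sigmaZZ : sigmaZ R *m sigmaZ R = 1%:M. Proof. by pauli. Qed.
Lemma sigmaXY : sigmaX R *m sigmaY R = I *: sigmaZ R. Proof. by pauli. Qed.
Lemma sigmaYX : sigmaY R *m sigmaX R = - I *: sigmaZ R. Proof. by pauli. Qed.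
Lemma sigmaYZ : sigmaY R *m sigmaZ R = I *: sigmaX R. Proof. by pauli. Qed.
Lemma sigmaZY : sigmaZ R *m sigmaY R = - I *: sigmaX R. Proof. by pauli. Qed.
Lemma sigmaZX : sigmaZ R *m sigmaX R = I *: sigmaY R. Proof. by pauli. Qed.
Lemma sigmaXZ : sigmaX R *m sigmaZ R = - I *: sigmaY R. Proof. by pauli. Qed.
End Pauli.

Section ZpSums.
Variable n : nat.
Hypothesis n_gt0 : (0 < n)%N.

Lemma sum_Zp (V : nmodType) (F : 'Z_(n.*2) -> V) :
  \sum_x F x = \sum_(0 <= j < n.*2) F j%:R.
Proof.
have n2 : (1 < n.*2)%N by rewrite -addnn -(addn1 1) leq_add.
rewrite -[X in index_iota 0 X](Zp_cast n2) big_mkord.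
by apply: eq_bigr => x _; rewrite natr_Zp.
Qed.

Lemma sum_half_period (V : nmodType) (F : 'Z_(n.*2) -> V) :
  (forall x, F (x + half n) = F x) -> \sum_x F x = (\sum_(j < n) F j%:R) *+ 2.
Proof.
move=> FP; rewrite sum_Zp (@big_cat_nat _ _ _ n) //=; last by rewrite -addnn leq_addr.
rewrite mulr2n.
rewrite big_mkord; congr (_ + _).
rewrite -{1}[n]add0n big_addn -[X in (X - n)%N]addnn addnK big_mkord; apply: eq_bigr => j _.
by rewrite natrD FP.
Qed.

End ZpSums.

(** * The symmetrised Pauli strings as Onsager generators *)

Section Identification.
Variables (R : realType) (n : nat).
Hypothesis n_gt0 : (0 < n)%N.
Local Notation C := R[i].
Local Notation I := (Num.imaginary : C).
Local Notation X := (pX R n).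
Local Notation Y := (pY R n).
Local Notation Z := (pZ R n).
Notation Mx := 'M[C]_(2 ^ n).

Let ltn_mod_eq j k : (j < n)%N -> (k < n)%N -> (j %% n == k %% n)%N = (j == k).
Proof. by move=> jn kn; rewrite !modn_small. Qed.

Lemma pX_sqr j : X j * X j = 1 :> Mx.
Proof. by rewrite -mulmxE on_qubitM sigmaXX on_qubit1. Qed.

Lemma on_qubit_selfC (P : 'M[C]_2) j k :
  on_qubit n P j *m on_qubit n P k = on_qubit n P k *m on_qubit n P j.
Proof.
have [jk|/on_qubit_comm//] := eqVneq (j %% n)%N (k %% n)%N.
by rewrite -(on_qubit_mod n P j) jk on_qubit_mod.
Qed.

Lemma on_qubit_anti (P Q : 'M[C]_2) j k : P *m Q = - (Q *m P) ->
  on_qubit n P j *m on_qubit n Q k =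
  if (j %% n == k %% n)%N then - (on_qubit n Q k *m on_qubit n P j)
  else on_qubit n Q k *m on_qubit n P j.
Proof.
move=> PQ; case: eqP => [jk|/eqP/on_qubit_comm//].
rewrite -(on_qubit_mod n P j) jk on_qubit_mod !on_qubitM PQ.
by rewrite -scaleN1r on_qubitZ // scaleN1r.
Qed.

Lemma pauli_anti_local (P : 'M[C]_2) : P *m P = 1%:M -> P *m sigmaX R = - (sigmaX R *m P) ->
  @anti_local Mx n X (on_qubit n P).
Proof.
move=> PP PX; split=> [j|j|j k|j k jn kn].
- by rewrite -mulmxE on_qubitM PP on_qubit1.
- exact: on_qubit_addn.
- exact: on_qubit_selfC.
- by rewrite -mulmxE on_qubit_anti // ltn_mod_eq.
Qed.

Lemma pZ_anti_local : @anti_local Mx n X Z.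
Proof.
apply: pauli_anti_local; first exact: sigmaZZ.
by rewrite sigmaZX sigmaXZ scaleNr opprK.
Qed.

Lemma pY_anti_local : @anti_local Mx n X Y.
Proof.
apply: pauli_anti_local; first exact: sigmaYY.
by rewrite sigmaYX sigmaXY scaleNr.
Qed.

Lemma sigmaZY_anti : sigmaZ R *m sigmaY R = - (sigmaY R *m sigmaZ R).
Proof. by rewrite sigmaZY sigmaYZ scaleNr. Qed.

Lemma sigmaZX_anti : sigmaZ R *m sigmaX R = - (sigmaX R *m sigmaZ R).
Proof. by rewrite sigmaZX sigmaXZ scaleNr opprK. Qed.

Lemma pZ_pY j k : (j < n)%N -> (k < n)%N ->
  Z j * Y k = if j == k then - (Y k * Z j) else Y k * Z j :> Mx.
Proof.
by move=> jn kn; rewrite -mulmxE (on_qubit_anti _ _ sigmaZY_anti) ltn_mod_eq.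
Qed.

Lemma pX_comm j k : X j * X k = X k * X j :> Mx.
Proof. exact: on_qubit_selfC. Qed.

Lemma pX_addn j : X (j + n)%N = X j.
Proof. exact: on_qubit_addn. Qed.

Definition hopn := @hopZY n Mx X Y Z.
Definition pairn := @pairZY n Mx X Y Z.

(* [onsA t] is [ZX^(t-1)Z] for 0 < t < n, [X^(n-1)] for t = n, [- X] for t = 0,
   and [onsA (- t)] is [YX^(t-1)Y]; [onsG t] is [YX^(t-1)Z]. *)
Definition onsA (t : 'Z_(n.*2)) : Mx := - 2^-1 *: hopn t.
Definition onsG (r : 'Z_(n.*2)) : Mx := 2^-1 *: pairn r.

Lemma onsG_N r : onsG (- r) = - onsG r.
Proof.
by rewrite /onsG /pairn (pairZYN n_gt0 pX_sqr pX_comm pX_addn pZ_anti_local pY_anti_local) scalerN.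
Qed.

Lemma bracketZ N (a b : C) (A B : 'M[C]_N) : bracket (a *: A) (b *: B) = (a * b) *: bracket A B.
Proof.
rewrite /bracket -!scalemxAl -!scalemxAr !scalerA scalerBr; congr (_ - _).
by rewrite mulrC.
Qed.

Lemma bracket_onsAA s t : bracket (onsA s) (onsA t) = 2 *: onsG (s - t).
Proof.
rewrite /onsA /onsG bracketZ /bracket mulmxE.
rewrite (comm_hop_hopZY n_gt0 pX_sqr pX_comm pX_addn pZ_anti_local pY_anti_local pZ_pY).
by rewrite mulr_natl -[_ *+ 4]scaler_nat !scalerA; congr (_ *: _); field.
Qed.

Lemma bracket_onsAG t r : bracket (onsA t) (onsG r) = 4 *: (onsA (t + r) - onsA (t - r)).
Proof.
rewrite /onsA /onsG bracketZ /bracket mulmxE.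
rewrite (comm_hop_pairZY n_gt0 pX_sqr pX_comm pX_addn pZ_anti_local pY_anti_local pZ_pY).
by rewrite mulr_natl -[_ *+ 8]scaler_nat -scalerBr !scalerA; congr (_ *: _); field.
Qed.

Local Notation run j t := (\prod_(l < t) X (j + l)%N : Mx).

(** The reason for [jw']: with the string to the right of [T], the common part S_j of the two
    strings squares to 1, and only the sites from j to j + d - 1 survive, even when they wrap
    around. *)
Lemma jw'_jw T U j d : jw' X T j * jw X U (j + d)%N = T j * run j d * U (j + d)%N.
Proof.
rewrite /jw' /jw (jw_stringD X) !mulrA -(mulrA (T j)).
by rewrite (jw_sqr pX_sqr pX_comm) mulr1.
Qed.

Lemma jw'_jw_rev T U j d : jw' X T (j + d)%N * jw X U j = T (j + d)%N * run j d * U j.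
Proof.
rewrite /jw' /jw !mulrA -(mulrA (T _)) (jw_jw pX_comm) (jw_stringD X) !mulrA.
by rewrite -(mulrA (T _)) (jw_sqr pX_sqr pX_comm) mulr1.
Qed.

(** A half turn puts P P = 1 between the two factors, so each site is counted twice over Z/2n; the
    1/2 in [onsA] and [onsG] removes this factor. *)
Lemma maj'_maj T U d : anti_local n X T -> anti_local n X U ->
  \sum_x @maj' n Mx X T x * @maj n Mx X U (x + d%:R) =
  (\sum_(j < n) T j * run j d * U (j + d)%N) *+ 2.
Proof.
move=> HT HU; rewrite (sum_half_period n_gt0); last first.
  move=> x; rewrite addrAC -(maj_half n_gt0 pX_sqr pX_comm pX_addn HU).
  rewrite -(maj'_half n_gt0 pX_sqr pX_comm pX_addn HT) mulrA -(mulrA (@maj' _ _ _ _ _)).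
  by rewrite (jw_sqr pX_sqr pX_comm) mulr1.
congr (_ *+ 2); apply: eq_bigr => j _.
rewrite -natrD (majE n_gt0 pX_sqr pX_comm pX_addn HU) (maj'E n_gt0 pX_sqr pX_comm pX_addn HT).
exact: jw'_jw.
Qed.

Lemma maj'_maj_rev T U d : anti_local n X T -> anti_local n X U ->
  \sum_x @maj' n Mx X T x * @maj n Mx X U (x - d%:R) =
  (\sum_(j < n) T (j + d)%N * run j d * U j) *+ 2.
Proof.
move=> HT HU; rewrite (reindex_inj (addIr d%:R)) /=.
under eq_bigr do rewrite addrK.
rewrite (sum_half_period n_gt0); last first.
  move=> x; rewrite addrAC -(maj_half n_gt0 pX_sqr pX_comm pX_addn HU).
  rewrite -(maj'_half n_gt0 pX_sqr pX_comm pX_addn HT) mulrA -(mulrA (@maj' _ _ _ _ _)).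
  by rewrite (jw_sqr pX_sqr pX_comm) mulr1.
congr (_ *+ 2); apply: eq_bigr => j _.
rewrite -natrD (majE n_gt0 pX_sqr pX_comm pX_addn HU) (maj'E n_gt0 pX_sqr pX_comm pX_addn HT).
exact: jw'_jw_rev.
Qed.

Lemma scale_half_double (a : C) (A : Mx) : (a / 2) *: (A *+ 2) = a *: A.
Proof. by rewrite -[A *+ 2]scaler_nat scalerA divfK ?pnatr_eq0. Qed.

Lemma half_double_sub (A B A' B' : Mx) :
  A = A' *+ 2 -> B = B' *+ 2 -> 2^-1 *: (A - B) = A' - B'.
Proof. by move=> -> ->; rewrite -mulrnBl -[2^-1]mul1r scale_half_double scale1r. Qed.

Lemma onsA_nat d : onsA d%:R = - \sum_(j < n) Y j * run j d * Z (j + d)%N.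
Proof.
rewrite /onsA /hopn /hopZY /hop (maj'_maj _ pY_anti_local pZ_anti_local).
by rewrite -mulN1r scale_half_double scaleN1r.
Qed.

Lemma onsA_neg d : onsA (- d%:R) = - \sum_(j < n) Y (j + d)%N * run j d * Z j.
Proof.
rewrite /onsA /hopn /hopZY /hop (maj'_maj_rev _ pY_anti_local pZ_anti_local).
by rewrite -mulN1r scale_half_double scaleN1r.
Qed.

Lemma onsG_nat d : onsG d%:R =
  \sum_(j < n) (Z j * run j d * Z (j + d)%N - Y j * run j d * Y (j + d)%N).
Proof.
rewrite /onsG /pairn /pairZY /pair sumrB [RHS]sumrB.
have EY := maj'_maj d pY_anti_local pY_anti_local.
have EZ := maj'_maj d pZ_anti_local pZ_anti_local.
exact: half_double_sub EZ EY.
Qed.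

Lemma Xrun_prod j t : Xrun R n j t = \prod_(l < t) X (j.+1 + l)%N :> Mx.
Proof.
by rewrite /Xrun big_add1 /= big_mkord; apply: eq_bigr => l _; rewrite addnS.
Qed.

Lemma runS j t : run j t.+1 = X j *m Xrun R n j t.
Proof.
rewrite big_ord_recl addn0 Xrun_prod mulmxE; congr (_ * _).
by apply: eq_bigr => l _; rewrite addSnnS.
Qed.

Lemma pYX j : Y j *m X j = - I *: Z j.
Proof. by rewrite on_qubitM sigmaYX on_qubitZ. Qed.
Lemma pZX j : Z j *m X j = I *: Y j.
Proof. by rewrite on_qubitM sigmaZX on_qubitZ. Qed.
Lemma pXZ j : X j *m Z j = - I *: Y j.
Proof. by rewrite on_qubitM sigmaXZ on_qubitZ. Qed.
Lemma pYZ j : Y j *m Z j = I *: X j.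
Proof. by rewrite on_qubitM sigmaYZ on_qubitZ. Qed.

Lemma symX_ons : symX R n = - onsA 0.
Proof.
rewrite -[0]/(0%:R) (onsA_nat 0) opprK /symX scaler_sumr ?complexiE; apply: eq_bigr => j _.
by rewrite big_ord0 mulr1 addn0 -mulmxE pYZ.
Qed.

(** The string of A_(t+1) starts at site j itself; Y_j X_j = -i Z_j turns its first factor into the
    left end and leaves t inner factors, whence the shift of the index by one. *)
Lemma symZXZ_ons t : symZXZ R n t = onsA t.+1%:R.
Proof.
rewrite onsA_nat /symZXZ ?complexiE scaler_sumr -sumrN; apply: eq_bigr => j _.
rewrite runS -!mulmxE mulmxA pYX -!scalemxAl scaleNr opprK.
by rewrite addn1 addnS.
Qed.

Lemma symYXZ_ons t : symYXZ R n t = onsG t.+1%:R.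
Proof.
rewrite onsG_nat /symYXZ ?complexiE scaler_sumr; apply: eq_bigr => j _.
rewrite runS -!mulmxE !mulmxA pYX pZX -!scalemxAl scaleNr opprK -scalerDr.
by rewrite addn1 addnS.
Qed.

Lemma Xrun_comm (P : 'M[C]_2) j k t : (forall l, (0 < l <= t)%N -> (j + l) %% n != k %% n)%N ->
  on_qubit n P k *m Xrun R n j t = Xrun R n j t *m on_qubit n P k.
Proof.
rewrite Xrun_prod; elim: t => [|t IH] H; first by rewrite big_ord0 mulmx1 mul1mx.
rewrite big_ord_recr /= -mulmxE mulmxA IH; last first.
  by move=> l /andP[l0 lt]; apply: H; rewrite l0 ltnW.
by rewrite -!mulmxA addSnnS (@on_qubit_comm _ _ P) // eq_sym H //= .
Qed.

Lemma modn_add_neq j l t : (0 < l)%N -> (l < n)%N -> ((j + t + l) %% n != (j + t) %% n)%N.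
Proof.
move=> l0 ln; rewrite -[X in (_ != X %% n)%N]addn0 eqn_modDl mod0n modn_small //.
by rewrite -lt0n.
Qed.

Lemma exchange_ends N (y x r z : 'M[C]_N) : y *m x = x *m y -> y *m r = r *m y ->
  y *m z = z *m y -> z *m r = r *m z -> y *m (x *m r) *m z = x *m z *m r *m y.
Proof.
move=> yx yr yz zr.
by rewrite mulmxA yx -!mulmxA (mulmxA y) yr -!mulmxA yz (mulmxA r) -zr !mulmxA.
Qed.

(** [onsA_neg] puts [Y] at the far end and [Z] at j. Since t + 1 < n, the far end is none of the
    sites j, ..., j + t, so its [Y] moves to the right of everything, and X_j Z_j = -i Y_j forms the
    left end. *)
Lemma symYXY_ons t : (t.+1 < n)%N -> symYXY R n t = onsA (- t.+1%:R).
Proof.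
move=> tn; rewrite onsA_neg /symYXY ?complexiE scaler_sumr -sumrN; apply: eq_bigr => j _.
rewrite runS -!mulmxE addn1 -addnS.
have Zr : Z j *m Xrun R n j t = Xrun R n j t *m Z j.
  apply: Xrun_comm => l /andP[l0 lt].
  by have := @modn_add_neq j l 0 l0 (leq_ltn_trans lt (ltnW tn)); rewrite addn0.
have Yr : Y (j + t.+1) *m Xrun R n j t = Xrun R n j t *m Y (j + t.+1).
  apply: Xrun_comm => l /andP[l0 lt].
  have := @modn_add_neq j (t.+1 - l) l; rewrite -addnA subnKC 1?leqW // eq_sym; apply.
    by rewrite subn_gt0.
  by apply: leq_ltn_trans tn; rewrite leq_subr.
have YX : Y (j + t.+1) *m X j = X j *m Y (j + t.+1).
  apply: on_qubit_comm.
  by have := @modn_add_neq j t.+1 0 isT tn; rewrite !addn0.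
have YZ : Y (j + t.+1) *m Z j = Z j *m Y (j + t.+1).
  apply: on_qubit_comm.
  by have := @modn_add_neq j t.+1 0 isT tn; rewrite !addn0.
rewrite (exchange_ends YX Yr YZ Zr).
by rewrite pXZ -!scalemxAl scaleNr opprK.
Qed.

Lemma sum_shift (V : nmodType) (F : nat -> V) : F n = F 0%N ->
  \sum_(j < n) F j.+1 = \sum_(j < n) F j.
Proof.
move=> Fn; rewrite -(big_mkord xpredT F) -(big_mkord xpredT (fun j => F j.+1)).
case: n Fn => [|m] Fn; first by rewrite !big_nil.
by rewrite big_nat_recr // Fn [RHS]big_nat_recl //= addrC.
Qed.

(** After a full turn the end [Z] is back at site j, where it commutes with the n - 1 remaining
    factors and cancels the [Z] made from Y_j X_j. *)
Lemma symXn1_ons : symXn1 R n = onsA n%:R.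
Proof.
rewrite onsA_nat /symXn1 ?complexiE.
(* The symbol starts its product at site j and [Xrun] at j + 1; the cyclic sum does not see the
   difference. *)
have -> : \sum_(j < n) (\big[mulmx/1%:M]_(l < n.-1) X (j + l)%N) = \sum_(j < n) Xrun R n j n.-1.
  transitivity (\sum_(j < n) run j n.-1); first by [].
  rewrite -(sum_shift (F := fun j => run j n.-1)); last first.
    by apply: eq_bigr => l _; rewrite add0n addnC pX_addn.
  by apply: eq_bigr => j _; rewrite Xrun_prod.
rewrite scaler_sumr -sumrN; apply: eq_bigr => j _.
have := runS j n.-1; rewrite (prednK n_gt0) => ->.
rewrite -!mulmxE mulmxA pYX -!scalemxAl scaleNr opprK.
rewrite /pZ on_qubit_addn.
rewrite (@Xrun_comm (sigmaZ R)); last first.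
  move=> l /andP[l0 lt].
  have := @modn_add_neq j l 0 l0; rewrite !addn0; apply.
  by rewrite -(prednK n_gt0) ltnS.
by rewrite -mulmxA on_qubitM sigmaZZ on_qubit1 mulmx1.
Qed.
End Identification.

(** * Trigonometric sums over Z/2n *)

Section CyclicTrig.
Variables (R : realType) (n : nat).
Hypothesis n_gt0 : (0 < n)%N.
Local Notation I := 'Z_(n.*2).

Definition cosZ (x : I) : R := cos ((x : nat)%:R * pi / n%:R).
Definition sinZ (x : I) : R := sin ((x : nat)%:R * pi / n%:R).

Let n2_gt1 : (1 < n.*2)%N. Proof. by rewrite -addnn -(addn1 1) leq_add. Qed.
Let n_neq0 : n%:R != 0 :> R. Proof. by rewrite pnatr_eq0 -lt0n. Qed.

Let dbl : n.*2%:R = 2 * n%:R :> R. Proof. by rewrite -mul2n natrM. Qed.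

Lemma angle_mod k : k%:R * pi / n%:R =
  (k %% n.*2)%:R * pi / n%:R + pi *+ 2 *+ (k %/ n.*2) :> R.
Proof.
rewrite {1}(divn_eq k n.*2) natrD natrM -addnn natrD addrC.
rewrite -[pi *+ 2 *+ _]mulr_natr -[pi *+ 2]mulr_natr; field; exact: n_neq0.
Qed.

Lemma cosZ_nat k : cosZ k%:R = cos (k%:R * pi / n%:R).
Proof. by rewrite /cosZ val_Zp_nat // [in RHS]angle_mod (periodicn (@cosD2pi R)). Qed.

Lemma sinZ_nat k : sinZ k%:R = sin (k%:R * pi / n%:R).
Proof. by rewrite /sinZ val_Zp_nat // [in RHS]angle_mod (periodicn (@sinD2pi R)). Qed.

Lemma cosZ0 : cosZ 0 = 1. Proof. by rewrite /cosZ !mul0r cos0. Qed.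
Lemma sinZ0 : sinZ 0 = 0. Proof. by rewrite /sinZ !mul0r sin0. Qed.

Lemma cosZD x y : cosZ (x + y) = cosZ x * cosZ y - sinZ x * sinZ y.
Proof.
by rewrite -[x]natr_Zp -[y]natr_Zp -natrD !cosZ_nat !sinZ_nat natrD !mulrDl cosD.
Qed.

Lemma sinZD x y : sinZ (x + y) = sinZ x * cosZ y + cosZ x * sinZ y.
Proof.
by rewrite -[x]natr_Zp -[y]natr_Zp -natrD !cosZ_nat !sinZ_nat natrD !mulrDl sinD.
Qed.

Lemma cosZ2Dsin x : cosZ x ^+ 2 + sinZ x ^+ 2 = 1.
Proof. exact: cos2Dsin2. Qed.

(** The representative of [- x] is 2n - x, so the parity of cos does not apply directly; the
    addition formulas for x + (- x) = 0 form a linear system of determinant 1 that yields the values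
    at [- x]. *)
Lemma cosZN x : cosZ (- x) = cosZ x.
Proof.
have H1 := cosZD x (- x); have H2 := sinZD x (- x).
rewrite subrr cosZ0 in H1; rewrite subrr sinZ0 in H2; have H3 := cosZ2Dsin x.
transitivity (cosZ (- x) * (cosZ x ^+ 2 + sinZ x ^+ 2)); first by rewrite H3 mulr1.
transitivity (cosZ x * (cosZ x * cosZ (- x) - sinZ x * sinZ (- x))
  + sinZ x * (sinZ x * cosZ (- x) + cosZ x * sinZ (- x))).
  by ring.
by rewrite -H1 -H2 mulr0 addr0 mulr1.
Qed.

Lemma sinZN x : sinZ (- x) = - sinZ x.
Proof.
have H1 := cosZD x (- x); have H2 := sinZD x (- x).
rewrite subrr cosZ0 in H1; rewrite subrr sinZ0 in H2; have H3 := cosZ2Dsin x.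
transitivity (sinZ (- x) * (cosZ x ^+ 2 + sinZ x ^+ 2)); first by rewrite H3 mulr1.
transitivity (- sinZ x * (cosZ x * cosZ (- x) - sinZ x * sinZ (- x))
  + cosZ x * (sinZ x * cosZ (- x) + cosZ x * sinZ (- x))).
  by ring.
by rewrite -H1 -H2 mulr0 addr0 mulr1.
Qed.

(** Half the angle of x lies strictly between 0 and pi, so its sine is nonzero and cos (2 h) = 1 - 2
    sin^2 h < 1. *)
Lemma cosZ_neq1 x : x != 0 -> cosZ x != 1.
Proof.
move=> x0; have xgt0 : (0 < (x : nat))%N.
  by rewrite lt0n; apply: contra_neq x0 => x0; apply: val_inj.
have xlt : (x < n.*2)%N by rewrite -{2}(Zp_cast n2_gt1) ltn_ord.
set h : R := (x : nat)%:R * pi / n.*2%:R.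
have n2_gt0 : 0 < n.*2%:R :> R by rewrite ltr0n ltnW.
have h0 : 0 < h by rewrite divr_gt0 // mulr_gt0 ?pi_gt0 ?ltr0n.
have h1 : h < pi.
  by rewrite ltr_pdivrMr // mulrC ltr_pM2l ?pi_gt0 // ltr_nat.
have -> : cosZ x = cos (h *+ 2).
  by rewrite /cosZ /h; congr cos; rewrite dbl; field; exact: n_neq0.
have := sin_gt0_pi (x := h); rewrite h0 h1 => /(_ isT) s0.
rewrite cos_mulr2n; apply/eqP => e.
have := cos2Dsin2 h; nra.
Qed.

(* Both sums are invariant under the shift t -> t + 1, which rotates the vector
   they form by the angle of [m]. *)
Lemma sum_cos_sinZ m : m != 0 -> \sum_t cosZ (m * t) = 0 /\ \sum_t sinZ (m * t) = 0.
Proof.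
move=> m0; set Sc := \sum_t _; set Ss := \sum_t _.
have E1 : Sc = cosZ m * Sc - sinZ m * Ss.
  rewrite {1}/Sc (reindex_inj (addrI 1)) /= !mulr_sumr -sumrB.
  by apply: eq_bigr => t _; rewrite mulrDr mulr1 cosZD.
have E2 : Ss = sinZ m * Sc + cosZ m * Ss.
  rewrite {1}/Ss (reindex_inj (addrI 1)) /= !mulr_sumr -big_split /=.
  by apply: eq_bigr => t _; rewrite mulrDr mulr1 sinZD.
(* This is the determinant of the identity minus the rotation; the combinations below are Cramer's
   rule. *)
have c1 : 2 * (1 - cosZ m) != 0.
  by rewrite mulf_neq0 ?pnatr_eq0 // subr_eq0 eq_sym cosZ_neq1.
have H3 := cosZ2Dsin m.
split; apply: (mulfI c1); rewrite mulr0.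
  transitivity ((1 - cosZ m) * (Sc - (cosZ m * Sc - sinZ m * Ss))
    - sinZ m * (Ss - (sinZ m * Sc + cosZ m * Ss)) + (1 - (cosZ m ^+ 2 + sinZ m ^+ 2)) * Sc).
    by ring.
  by rewrite -E1 -E2 H3 !subrr !mulr0 mul0r subrr addr0.
transitivity ((1 - cosZ m) * (Ss - (sinZ m * Sc + cosZ m * Ss))
    + sinZ m * (Sc - (cosZ m * Sc - sinZ m * Ss)) + (1 - (cosZ m ^+ 2 + sinZ m ^+ 2)) * Ss).
  by ring.
by rewrite -E1 -E2 H3 !subrr !mulr0 mul0r !addr0.
Qed.

Lemma sum_cosZ m : \sum_t cosZ (m * t) = if m == 0 then n.*2%:R else 0.
Proof.
have [->|/sum_cos_sinZ[]//] := eqVneq.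
under eq_bigr do rewrite mul0r cosZ0.
by rewrite sumr_const card_ord Zp_cast.
Qed.

Lemma sum_sinZ m : \sum_t sinZ (m * t) = 0.
Proof.
have [->|/sum_cos_sinZ[]//] := eqVneq m 0.
by rewrite big1 // => t _; rewrite mul0r sinZ0.
Qed.

(** Product-to-sum: the frequency k + l sums to 0 by hypothesis, and so does k - l unless k = l. For
    k = l the hypothesis excludes 0 and [half n], where the value would be 2n. *)
Lemma sum_cos_cos k l : k + l != 0 ->
  \sum_t cosZ (k * t) * cosZ (l * t) = if k == l then n%:R else 0.
Proof.
move=> kl; have two : 2 != 0 :> R by rewrite pnatr_eq0.
apply: (mulfI two).
transitivity (\sum_t cosZ ((k + l) * t) + \sum_t cosZ ((k - l) * t)).
  rewrite mulr_sumr -big_split /=; apply: eq_bigr => t _.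
  by rewrite (mulrDl k l t) (mulrBl t k l) !cosZD cosZN sinZN; ring.
by rewrite !sum_cosZ (negPf kl) subr_eq0 add0r dbl; case: eqP; rewrite ?mulr0.
Qed.

Lemma sum_sin_sin k l : k + l != 0 ->
  \sum_t sinZ (k * t) * sinZ (l * t) = if k == l then n%:R else 0.
Proof.
move=> kl; have two : 2 != 0 :> R by rewrite pnatr_eq0.
apply: (mulfI two).
transitivity (\sum_t cosZ ((k - l) * t) - \sum_t cosZ ((k + l) * t)).
  rewrite mulr_sumr -sumrB /=; apply: eq_bigr => t _.
  by rewrite (mulrDl k l t) (mulrBl t k l) !cosZD cosZN sinZN; ring.
by rewrite !sum_cosZ (negPf kl) subr_eq0 subr0 dbl; case: eqP; rewrite ?mulr0.
Qed.

Lemma sum_sin_cos k l : \sum_t sinZ (k * t) * cosZ (l * t) = 0.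
Proof.
have two : 2 != 0 :> R by rewrite pnatr_eq0.
apply: (mulfI two).
transitivity (\sum_t sinZ ((k + l) * t) + \sum_t sinZ ((k - l) * t)).
  rewrite mulr_sumr -big_split /=; apply: eq_bigr => t _.
  by rewrite (mulrDl k l t) (mulrBl t k l) !sinZD cosZN sinZN; ring.
by rewrite !sum_sinZ addr0 mulr0.
Qed.

End CyclicTrig.

(** * Real Lie algebras of matrices and su(2) triples *)

(* Specializations of the generic morphism lemmas: rewriting with the latter is
   prohibitively slow over [R[i]]. *)
Section RealScalars.
Variable R : realType.
Implicit Types a b : R.

Lemma realcD a b : (a + b)%:C = a%:C + b%:C. Proof. exact: rmorphD. Qed.
Lemma realcB a b : (a - b)%:C = a%:C - b%:C. Proof. exact: rmorphB. Qed.
Lemma realcM a b : (a * b)%:C = a%:C * b%:C. Proof. exact: rmorphM. Qed.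
Lemma realcN a : (- a)%:C = - a%:C. Proof. exact: rmorphN. Qed.
Lemma realc_nat m : (m%:R : R)%:C = m%:R. Proof. exact: rmorph_nat. Qed.
Lemma realc2 : (2 : R)%:C = 2. Proof. exact: realc_nat. Qed.
Lemma realcV a : (a^-1)%:C = (a%:C)^-1. Proof. exact: fmorphV. Qed.
Lemma realc_sum (I : Type) (r : seq I) (P : pred I) (F : I -> R) :
  (\sum_(i <- r | P i) F i)%:C = \sum_(i <- r | P i) (F i)%:C.
Proof. exact: rmorph_sum. Qed.

End RealScalars.

Section Bracket.
Variables (R : realType) (N : nat).
Local Notation C := R[i].
Implicit Types A B D : 'M[C]_N.

Lemma bracketDl A B D : bracket (A + B) D = bracket A D + bracket B D.
Proof. by rewrite /bracket mulmxDl mulmxDr opprD addrACA. Qed.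

Lemma bracketDr A B D : bracket D (A + B) = bracket D A + bracket D B.
Proof. by rewrite /bracket mulmxDl mulmxDr opprD addrACA. Qed.

Lemma bracketZl (a : C) A B : bracket (a *: A) B = a *: bracket A B.
Proof. by rewrite /bracket -scalemxAl -scalemxAr scalerBr. Qed.

Lemma bracketZr (a : C) A B : bracket A (a *: B) = a *: bracket A B.
Proof. by rewrite /bracket -scalemxAl -scalemxAr scalerBr. Qed.

Lemma bracketC A B : bracket A B = - bracket B A.
Proof. by rewrite /bracket opprB. Qed.

Lemma bracketxx A : bracket A A = 0.
Proof. exact: subrr. Qed.

Lemma bracket0l A : bracket 0 A = 0.
Proof. by rewrite /bracket mul0mx mulmx0 subrr. Qed.

Lemma bracket0r A : bracket A 0 = 0.
Proof. by rewrite /bracket mul0mx mulmx0 subrr. Qed.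

Lemma bracketNr A B : bracket A (- B) = - bracket A B.
Proof. by rewrite -scaleN1r bracketZr scaleN1r. Qed.

Lemma bracket_suml (I : Type) (r : seq I) (P : pred I) (F : I -> 'M[C]_N) A :
  bracket (\sum_(i <- r | P i) F i) A = \sum_(i <- r | P i) bracket (F i) A.
Proof. by rewrite /bracket mulmx_suml mulmx_sumr -sumrB. Qed.

Lemma bracket_sumr (I : Type) (r : seq I) (P : pred I) (F : I -> 'M[C]_N) A :
  bracket A (\sum_(i <- r | P i) F i) = \sum_(i <- r | P i) bracket A (F i).
Proof. by rewrite /bracket mulmx_suml mulmx_sumr -sumrB. Qed.

Lemma jacobi A B D : bracket A (bracket B D) = bracket (bracket A B) D + bracket B (bracket A D).
Proof.
rewrite /bracket !mulmxBl !mulmxBr !mulmxA !opprB.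
rewrite !addrA; apply/eqP; rewrite -subr_eq0; apply/eqP.
move: (A *m B *m D) (A *m D *m B) (B *m D *m A)
  (D *m B *m A) (B *m A *m D) (D *m A *m B) => a b c d e f.
rewrite !opprD !opprK !addrA.
by apply/matrixP=> i j; rewrite !mxE; ring.
Qed.

End Bracket.

(** The nine brackets of basis vectors collected: twice the cross product of the coefficient vectors
    (u, v, w) and (u', v', w'). *)
Lemma comb3_expand (F : comPzRingType) (V : lmodType F) (u v w u' v' w' : F) (x y z : V) :
  u *: (u' *: 0) + u *: (v' *: (2 *: z)) + u *: (w' *: - (2 *: y)) +
  (v *: (u' *: - (2 *: z)) + v *: (v' *: 0) + v *: (w' *: (2 *: x))) +
  (w *: (u' *: (2 *: y)) + w *: (v' *: - (2 *: x)) + w *: (w' *: 0)) =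
  (2 * (v * w' - w * v')) *: x + (2 * (w * u' - u * w')) *: y +
  (2 * (u * v' - v * u')) *: z.
Proof.
rewrite !scaler0 !scalerN !scalerA !add0r !addr0 !mulrBr !scalerBl.
rewrite [LHS](AC (2*2*2) ((4*6)*(5*2)*(1*3))) /=.
by congr (_ + _ + _); congr (_ - _); congr (_ *: _); rewrite mulrC mulrA.
Qed.

Section Su2.
Variables (R : realType) (N : nat).
Local Notation C := R[i].
Implicit Types x y z A B : 'M[C]_N.

Definition comb3 x y z (a b c : R) : 'M[C]_N := a%:C *: x + b%:C *: y + c%:C *: z.

Definition span3 x y z : set 'M[C]_N := [set A | exists a b c, A = comb3 x y z a b c].

Definition su2_triple x y z : Prop :=
  [/\ bracket x y = 2 *: z, bracket y z = 2 *: x & bracket z x = 2 *: y].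

Lemma su2_triple_rot x y z : su2_triple x y z -> su2_triple y z x.
Proof. by case. Qed.

Lemma comb3_rot x y z a b c : comb3 x y z a b c = comb3 y z x b c a.
Proof. by rewrite /comb3 -addrA addrC. Qed.

Lemma span3_rot x y z : span3 x y z = span3 y z x.
Proof.
apply/seteqP; split=> A [a [b [c ->]]]; first by exists b, c, a; rewrite comb3_rot.
by exists c, a, b; rewrite -comb3_rot.
Qed.

Lemma span3_fst x y z : span3 x y z x.
Proof. by exists 1, 0, 0; rewrite /comb3 scale1r !scale0r !addr0. Qed.
Lemma span3_snd x y z : span3 x y z y.
Proof. by rewrite span3_rot; exact: span3_fst. Qed.
Lemma span3_trd x y z : span3 x y z z.
Proof. by rewrite 2!span3_rot; exact: span3_fst. Qed.

Lemma comb3_lin x y z r a b c a' b' c' :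
  r%:C *: comb3 x y z a b c + comb3 x y z a' b' c' =
  comb3 x y z (r * a + a') (r * b + b') (r * c + c').
Proof.
rewrite /comb3 !realcD !realcM !scalerDr !scalerA !scalerDl addrACA.
by congr (_ + _); rewrite addrACA.
Qed.

Lemma span3_subspace x y z : real_subspace (span3 x y z).
Proof.
split=> [|r A B [a [b [c ->]]] [a' [b' [c' ->]]]].
  by exists 0, 0, 0; rewrite /comb3 !scale0r !addr0.
by rewrite comb3_lin; do 3!eexists.
Qed.

Section Triple.
Variables x y z : 'M[C]_N.
Hypothesis T : su2_triple x y z.

Lemma bracket_comb3 a b c a' b' c' :
  bracket (comb3 x y z a b c) (comb3 x y z a' b' c') =
  comb3 x y z (2 * (b * c' - c * b')) (2 * (c * a' - a * c')) (2 * (a * b' - b * a')).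
Proof.
case: T => xy yz zx.
rewrite /comb3 !bracketDl !bracketDr !bracketZl !bracketZr !bracketxx.
rewrite (bracketC y x) (bracketC z y) (bracketC x z) xy yz zx.
by rewrite !realcM !realcB !realcM realc2; exact: (@comb3_expand C).
Qed.

Lemma span3_bracket A B : span3 x y z A -> span3 x y z B -> span3 x y z (bracket A B).
Proof.
by move=> [a [b [c ->]]] [a' [b' [c' ->]]]; rewrite bracket_comb3; do 3!eexists.
Qed.

(* The projector of the ideal argument: [ad x] squared is -4 on the plane of [y]
   and [z], and 0 on [x]. *)
Lemma double_bracket a b c :
  (4^-1)%:C *: bracket x (bracket x (comb3 x y z a b c)) + comb3 x y z a b c = a%:C *: x.
Proof.
have xE : x = comb3 x y z 1 0 0 by rewrite /comb3 scale1r !scale0r !addr0.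
rewrite {1 2}xE !bracket_comb3 comb3_lin /comb3.
have -> : 4^-1 * (2 * (0 * (2 * (1 * b - 0 * a)) - 0 * (2 * (0 * a - 1 * c)))) + a = a by ring.
have -> : 4^-1 * (2 * (0 * (2 * (0 * c - 0 * b)) - 1 * (2 * (1 * b - 0 * a)))) + b = 0 by field.
have -> : 4^-1 * (2 * (1 * (2 * (0 * a - 1 * c)) - 0 * (2 * (0 * c - 0 * b)))) + c = 0 by field.
by rewrite !scale0r !addr0.
Qed.

(** [double_bracket] extracts a multiple of x from the given element, so x lies in h; brackets of z
    and y with x then give y and z. The cyclic symmetry [su2_triple_rot] carries this over to the
    other two coefficients. *)
Lemma su2_ideal_mem (h : set 'M[C]_N) a b c : lie_ideal h (span3 x y z) ->
  h (comb3 x y z a b c) -> a != 0 -> span3 x y z `<=` h.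
Proof.
case=> [[h0 hl] hs hb] hA a0.
have hx : h x.
  have := hl a^-1 _ _ (hl 4^-1 _ _ (hb _ _ (span3_fst x y z) (hb _ _ (span3_fst x y z) hA)) hA) h0.
  by rewrite double_bracket addr0 scalerA -realcM mulVf // scale1r.
case: T => xy yz zx.
have half : 2^-1%:C * 2 = 1 :> C.
  by rewrite -realc2 -realcM mulVf ?pnatr_eq0.
have hy : h y.
  have := hl 2^-1 _ _ (hb _ _ (span3_trd x y z) hx) h0.
  by rewrite zx addr0 scalerA half scale1r.
have hz : h z.
  have := hl (- 2^-1) _ _ (hb _ _ (span3_snd x y z) hx) h0.
  by rewrite (bracketC y x) xy addr0 realcN scaleNr scalerN opprK scalerA half scale1r.
move=> _ [a' [b' [c' ->]]].
by have := hl a' _ _ hx (hl b' _ _ hy (hl c' _ _ hz h0)); rewrite addr0 addrA.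
Qed.

End Triple.

Lemma su2_neq0 x y z : su2_triple x y z -> y <> 0 -> x <> 0.
Proof.
move=> [xy _ zx] y0 x0; apply: y0; have two : 2 != 0 :> C by rewrite pnatr_eq0.
by apply: (scalerI two); rewrite -zx x0 bracket0r scaler0.
Qed.

Lemma comb3_eq0 x y z a b c : su2_triple x y z -> x <> 0 ->
  comb3 x y z a b c = 0 -> a = 0.
Proof.
move=> T x0 e; have := double_bracket T a b c.
rewrite e !bracket0r scaler0 addr0 => /esym/eqP.
by rewrite scaler_eq0 => /orP[/eqP[]//|/eqP/x0].
Qed.

Lemma comb3_free x y z a b c : su2_triple x y z -> y <> 0 ->
  comb3 x y z a b c = 0 -> [/\ a = 0, b = 0 & c = 0].
Proof.
move=> T y0 e; have x0 := su2_neq0 T y0.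
have T' := su2_triple_rot T; have T'' := su2_triple_rot T'.
have z0 : z <> 0 by exact: su2_neq0 T'' x0.
split; first exact: comb3_eq0 T x0 e.
  by rewrite comb3_rot in e; exact: comb3_eq0 T' y0 e.
by rewrite 2!comb3_rot in e; exact: comb3_eq0 T'' z0 e.
Qed.

Lemma su2_simple x y z : su2_triple x y z -> y <> 0 -> simple_lie (span3 x y z).
Proof.
move=> T y0; have x0 := su2_neq0 T y0.
have T' := su2_triple_rot T; have T'' := su2_triple_rot T'.
have z0 : z <> 0 by exact: su2_neq0 T'' x0.
split.
  exists x, y; split; [exact: span3_fst|exact: span3_snd|].
  case: T => -> _ _ /eqP; rewrite scaler_eq0 pnatr_eq0 /= => /eqP; exact: z0.
move=> h hI; have [[h00 hl] hs hb] := hI.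
have [h0|/existsNP[A /not_implyP[hA A0]]] := pselect (forall A, h A -> A = 0).
  by left; apply/seteqP; split=> A; [exact: h0 | move=> ->].
right; apply/seteqP; split => //.
have [a [b [c AE]]] := hs _ hA.
rewrite {}AE in hA A0.
have [a0|a0] := eqVneq a 0; last exact: (su2_ideal_mem T hI hA a0).
have [b0|b0] := eqVneq b 0; last first.
  by rewrite comb3_rot in hA; rewrite span3_rot in hI *; exact: (su2_ideal_mem T' hI hA b0).
have [c0|c0] := eqVneq c 0; last first.
  by rewrite 2!comb3_rot in hA; rewrite 2!span3_rot in hI *; exact: (su2_ideal_mem T'' hI hA c0).
by case: A0; rewrite a0 b0 c0 /comb3 !scale0r !addr0.
Qed.

End Su2.

Lemma su2_iso (R : realType) N M (x y z : 'M[R[i]]_N) (x' y' z' : 'M[R[i]]_M) :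
  su2_triple x y z -> y <> 0 -> su2_triple x' y' z' -> y' <> 0 ->
  lie_isomorphic (span3 x y z) (span3 x' y' z').
Proof.
move=> T y0 T' y0'.
have inj n (u v w : 'M[R[i]]_n) a b c a' b' c' : su2_triple u v w -> v <> 0 ->
   comb3 u v w a b c = comb3 u v w a' b' c' -> [/\ a = a', b = b' & c = c'].
  move=> Tu v0 e.
  have : comb3 u v w (-1 * a + a') (-1 * b + b') (-1 * c + c') = 0.
    by rewrite -comb3_lin e realcN scaleN1r addNr.
  by move/(comb3_free Tu v0)=> [/eqP]; rewrite !mulN1r ![- _ + _]addrC !subr_eq0
    => /eqP-> /eqP /[!subr_eq0] /eqP -> /eqP /[!subr_eq0] /eqP ->.
(* [f] copies coordinates, which [inj] shows to be well defined; outside the span the condition is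
   empty and the value is 0. *)
have /(@choice _ _ _)[f fE] : forall A, exists B, forall a b c,
    A = comb3 x y z a b c -> B = comb3 x' y' z' a b c.
  move=> A.
  have [[a [b [c ->]]]|nA] := pselect (span3 x y z A).
    by exists (comb3 x' y' z' a b c) => a' b' c' /(inj _ _ _ _ _ _ _ _ _ _ T y0)[-> -> ->].
  by exists 0 => a b c e; case: nA; exists a, b, c.
exists f; split.
- move=> r A B [a [b [c ->]]] [a' [b' [c' ->]]].
  by rewrite (fE _ _ _ _ (comb3_lin _ _ _ _ _ _ _ _ _ _)) !(fE _ _ _ _ erefl) comb3_lin.
- move=> A B [a [b [c ->]]] [a' [b' [c' ->]]].
  by rewrite (fE _ _ _ _ (bracket_comb3 T _ _ _ _ _ _)) !(fE _ _ _ _ erefl) bracket_comb3.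
- split.
  + by move=> A [a [b [c ->]]]; rewrite (fE _ _ _ _ erefl); exists a, b, c.
  + move=> A B /set_mem[a [b [c ->]]] /set_mem[a' [b' [c' ->]]].
    by rewrite !(fE _ _ _ _ erefl) => /(inj _ _ _ _ _ _ _ _ _ _ T' y0')[-> -> ->].
  + move=> A [a [b [c ->]]]; exists (comb3 x y z a b c); first by exists a, b, c.
    exact: fE.
Qed.

(** * The Pauli matrices as a model of su(2) *)

Section SuTwo.
Variable R : realType.
Local Notation C := R[i].
Local Notation I := (Num.imaginary : C).
Local Notation sX := (I *: sigmaX R).
Local Notation sY := (I *: sigmaY R).
Local Notation sZ := (I *: sigmaZ R).

Lemma bracket_sigma (a b : 'M[C]_2) (c : 'M[C]_2) : a *m b = - I *: c -> b *m a = I *: c ->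
  bracket (I *: a) (I *: b) = 2 *: (I *: c).
Proof.
move=> ab ba; rewrite bracketZl bracketZr /bracket ab ba scaleNr -opprD -mulr2n.
rewrite scalerA -expr2 sqrCi scaleN1r opprK.
by rewrite -[X in X = _]scaler_nat.
Qed.

(** Multiplication by i reverses the sign of the Pauli commutation relations, so the triple is
    positively oriented in the order X, Z, Y. *)
Lemma sigma_triple : su2_triple sX sZ sY.
Proof.
split; apply: bracket_sigma; rewrite ?sigmaXZ ?sigmaZX ?sigmaZY ?sigmaYZ ?sigmaYX ?sigmaXY //.
Qed.

Lemma sigmaZ_neq0 : sZ <> 0.
Proof.
move=> /matrixP/(_ 0 0)/eqP; rewrite !mxE /= mulr1 -[_ == _]/(Num.imaginary == 0 :> C).
by rewrite (negPf (neq0Ci _)).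
Qed.

Lemma comb3_sigma a b c :
  comb3 sX sZ sY a b c = mx2 (Complex 0 b) (Complex c a) (Complex (- c) a) (Complex 0 (- b)).
Proof.
rewrite -!complexiE /comb3 !mx2Z.
apply/matrixP=> i j; rewrite !mxE.
case: i => -[|[|//]] hi; case: j => -[|[|//]] hj /=.
all: rewrite /GRing.mul /GRing.add /=; congr Complex; ring.
Qed.

Lemma mx2_eta (A : 'M[C]_2) : A = mx2 (A 0 0) (A 0 1) (A 1 0) (A 1 1).
Proof.
apply/matrixP=> i j; rewrite !mxE.
by case: i => -[|[|//]] hi; case: j => -[|[|//]] hj; congr (A _ _); apply: val_inj.
Qed.

Lemma mx2_inj (a b c d a' b' c' d' : C) : mx2 a b c d = mx2 a' b' c' d' ->
  [/\ a = a', b = b', c = c' & d = d'].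
Proof.
by move=> /matrixP e; split;
  [have := e 0 0|have := e 0 1|have := e 1 0|have := e 1 1]; rewrite !mxE.
Qed.

Lemma mx2_adjoint (a b c d : C) : (mx2 a b c d)^t* = mx2 a^* c^* b^* d^*.
Proof.
apply/matrixP=> i j; rewrite !mxE.
by case: i => -[|[|//]] hi; case: j => -[|[|//]] hj.
Qed.

Lemma mx2_trace (a b c d : C) : \tr (mx2 a b c d) = a + d.
Proof. by rewrite /mxtrace !big_ord_recl big_ord0 addr0 !mxE. Qed.

Lemma mx2N (a b c d : C) : - mx2 a b c d = mx2 (- a) (- b) (- c) (- d).
Proof.
apply/matrixP=> i j; rewrite !mxE.
by case: i => -[|[|//]] hi; case: j => -[|[|//]] hj.
Qed.

Let ReIm (u v : C) : u = v -> complex.Re u = complex.Re v /\ complex.Im u = complex.Im v.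
Proof. by move=> ->. Qed.

Lemma su2E : su R 2 = span3 sX sZ sY.
Proof.
apply/seteqP; split=> A.
  rewrite [A]mx2_eta => -[].
  rewrite mx2_adjoint mx2N mx2_trace.
  case: (A 0 0) (A 0 1) (A 1 0) (A 1 1) => [p p'] [r r'] [q q'] [s s'].
  move=> /mx2_inj[/ReIm[/= h1 _] /ReIm[/= h2 h3] _ _] /ReIm[/= h4 h5].
  exists r', p', r; rewrite comb3_sigma.
  by congr (mx2 (Complex _ _) (Complex _ _) (Complex _ _) (Complex _ _)); lra.
move=> [a [b [c ->]]]; rewrite comb3_sigma; split.
  rewrite mx2_adjoint mx2N.
  by congr (mx2 (Complex _ _) (Complex _ _) (Complex _ _) (Complex _ _)); rewrite ?opprK ?oppr0.
by rewrite mx2_trace; congr Complex; rewrite ?addr0 ?addrN.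
Qed.
End SuTwo.

(** * Real subspaces and sums of commuting Lie subalgebras *)

Section Subspaces.
Variables (R : realType) (N : nat).
Local Notation Mx := 'M[R[i]]_N.

Section OneSubspace.
Variable V : set Mx.
Hypothesis HV : real_subspace V.

Lemma subspace0 : V 0. Proof. by case: HV. Qed.

Lemma subspaceD A B : V A -> V B -> V (A + B).
Proof. by case: HV => _ H VA VB; have := H 1 _ _ VA VB; rewrite scale1r. Qed.

Lemma subspaceZ (a : R) A : V A -> V (a%:C *: A).
Proof. by case: HV => V0 H VA; have := H a _ _ VA V0; rewrite addr0. Qed.

Lemma subspaceN A : V A -> V (- A).
Proof. by move=> /(@subspaceZ (-1)); rewrite realcN scaleN1r. Qed.

Lemma subspace_bigsum (I : Type) (r : seq I) (P : pred I) (F : I -> Mx) :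
  (forall i, P i -> V (F i)) -> V (\sum_(i <- r | P i) F i).
Proof.
by move=> VF; apply: big_ind => //; [exact: subspace0 | exact: subspaceD].
Qed.

Lemma subspaceZ_natV (m : nat) A : V A -> V (m%:R^-1 *: A).
Proof. by rewrite -realc_nat -realcV; exact: subspaceZ. Qed.

End OneSubspace.

Lemma lie_generated_subalgebra (S : set Mx) : lie_subalgebra (lie_generated S).
Proof.
split; last by move=> A B gA gB h Hh; case: (Hh) => [[_ hb] _]; apply: hb; [exact: gA|exact: gB].
split=> [h [[[h0 _] _] _] //|a A B gA gB h Hh]; case: (Hh) => [[[_ hl] _] _].
by apply: hl; [exact: gA|exact: gB].
Qed.

Lemma real_span_subspace (S : set Mx) : real_subspace (real_span S).
Proof.
split=> [h [[h0 _] _] //|a A B gA gB h Hh]; case: (Hh) => [[_ hl] _].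
by apply: hl; [exact: gA|exact: gB].
Qed.

Lemma lie_center_subspace (g : set Mx) : real_subspace g -> real_subspace (lie_center g).
Proof.
move=> Hg; split; first by split; [exact: subspace0 | move=> B _; rewrite bracket0l].
move=> a A B [gA cA] [gB cB]; split; first by apply: subspaceD => //; exact: subspaceZ.
by move=> D gD; rewrite bracketDl bracketZl cA // cB // scaler0 addr0.
Qed.

Section Family.
Variables (I : finType) (U : I -> set Mx).
Hypothesis HU : forall i, real_subspace (U i).

Lemma subspace_sum_subspace : real_subspace (subspace_sum U).
Proof.
split.
  by exists (fun=> 0); split; [move=> i; exact: subspace0 | rewrite big1].
move=> a _ _ [u [uU ->]] [v [vU ->]].
exists (fun i => a%:C *: u i + v i); split; last by rewrite scaler_sumr -big_split.
by move=> i; have [_] := HU i; apply.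
Qed.

Lemma sub_subspace_sum i : U i `<=` subspace_sum U.
Proof.
move=> A UA; exists (fun j => if j == i then A else 0); split.
  by move=> j; case: eqP => [->|_] //; exact: subspace0.
by rewrite -big_mkcond big_pred1_eq.
Qed.

Lemma subspace_sum_min (V : set Mx) : real_subspace V -> (forall i, U i `<=` V) ->
  subspace_sum U `<=` V.
Proof.
by move=> HV UV A [u [uU ->]]; apply: subspace_bigsum => // i _; exact: UV.
Qed.

Hypothesis U_bracket : forall i A B, U i A -> U i B -> U i (bracket A B).
Hypothesis U_comm : forall i j A B, i != j -> U i A -> U j B -> bracket A B = 0.

Lemma bracket_sum_sum (u v : I -> Mx) : (forall i, U i (u i)) -> (forall i, U i (v i)) ->
  bracket (\sum_i u i) (\sum_i v i) = \sum_i bracket (u i) (v i).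
Proof.
move=> uU vU; rewrite bracket_suml; apply: eq_bigr => i _.
rewrite bracket_sumr (bigD1 i) //= big1 ?addr0 // => j ji.
by apply: (U_comm (i := i) (j := j)); rewrite 1?eq_sym.
Qed.

Lemma bracket_sum_one (u : I -> Mx) i B : (forall i, U i (u i)) -> U i B ->
  bracket (\sum_i u i) B = bracket (u i) B.
Proof.
move=> uU UB; rewrite bracket_suml (bigD1 i) //= big1 ?addr0 // => j ji.
exact: (U_comm (i := j) (j := i)).
Qed.

Lemma subspace_sum_lie : lie_subalgebra (subspace_sum U).
Proof.
split; first exact: subspace_sum_subspace.
move=> _ _ [u [uU ->]] [v [vU ->]]; rewrite bracket_sum_sum //.
by exists (fun i => bracket (u i) (v i)); split=> // i; exact: U_bracket.
Qed.

(** Bracketing the vanishing sum with an element of [U i] kills all other components, so [u i]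
    centralises [U i]. *)
Lemma sum_eq0_component (u : I -> Mx) i : (forall i, U i (u i)) -> \sum_i u i = 0 ->
  (forall A, U i A -> (forall B, U i B -> bracket A B = 0) -> A = 0) -> u i = 0.
Proof.
move=> uU u0 centerless; apply: centerless => // B UB.
by rewrite -(bracket_sum_one uU UB) u0 bracket0l.
Qed.

End Family.

(** By [double_bracket], commuting with x makes A a multiple of x and commuting with y makes it a
    multiple of y; x and y are independent. *)
Lemma su2_centerless (x y z A : Mx) : su2_triple x y z -> y <> 0 -> span3 x y z A ->
  (forall B, span3 x y z B -> bracket A B = 0) -> A = 0.
Proof.
move=> T y0 [a [b [c AE]]] cA; have x0 := su2_neq0 T y0.
have Ax := double_bracket T a b c; have Ay := double_bracket (su2_triple_rot T) b c a.
rewrite -comb3_rot -AE in Ay; rewrite -AE in Ax.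
have /eqP := cA _ (span3_fst x y z); rewrite bracketC oppr_eq0 => /eqP xA.
have /eqP := cA _ (span3_snd x y z); rewrite bracketC oppr_eq0 => /eqP yA.
rewrite xA bracket0r scaler0 add0r in Ax; rewrite yA bracket0r scaler0 add0r in Ay.
have : comb3 x y z a (- b) 0 = 0.
  by rewrite /comb3 realcN scaleNr -Ax -Ay subrr add0r scale0r.
by move/(comb3_eq0 T x0) => a0; rewrite Ax a0 scale0r.
Qed.

End Subspaces.

(** * Fourier modes of the Onsager relations *)

Section Onsager.
Variables (R : realType) (n N : nat).
Hypothesis n_gt0 : (0 < n)%N.
Local Notation I := 'Z_(n.*2).
Local Notation Mx := 'M[R[i]]_N.
Variables A G : I -> Mx.
Hypothesis AA : forall s t, bracket (A s) (A t) = 2 *: G (s - t).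
Hypothesis AG : forall t r, bracket (A t) (G r) = 4 *: (A (t + r) - A (t - r)).
Hypothesis GN : forall r, G (- r) = - G r.

Definition Acomb (f : I -> R) : Mx := \sum_t (f t)%:C *: A t.
Definition Gcomb (g : I -> R) : Mx := \sum_r (g r)%:C *: G r.

Lemma eq_Acomb f g : f =1 g -> Acomb f = Acomb g.
Proof. by move=> fg; apply: eq_bigr => t _; rewrite fg. Qed.

Lemma eq_Gcomb f g : f =1 g -> Gcomb f = Gcomb g.
Proof. by move=> fg; apply: eq_bigr => t _; rewrite fg. Qed.

Lemma AcombZ a f : Acomb (fun t => a * f t) = a%:C *: Acomb f.
Proof. by rewrite /Acomb scaler_sumr; apply: eq_bigr => t _; rewrite realcM scalerA. Qed.

Lemma GcombZ a f : Gcomb (fun t => a * f t) = a%:C *: Gcomb f.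
Proof. by rewrite /Gcomb scaler_sumr; apply: eq_bigr => t _; rewrite realcM scalerA. Qed.

(** [G] is odd, so r and -r cancel. This is what makes sine modes commute with each other, cosine
    modes likewise, and the exceptional modes central. *)
Lemma Gcomb_even g : (forall r, g (- r) = g r) -> Gcomb g = 0.
Proof.
move=> ge; have E : Gcomb g = - Gcomb g.
  rewrite {1}/Gcomb (reindex_inj oppr_inj) /= -sumrN.
  by apply: eq_bigr => r _; rewrite ge GN scalerN.
have two : (2 : R[i]) != 0 by rewrite pnatr_eq0.
by apply: (scalerI two); rewrite scaler0 scaler_nat mulr2n {1}E addNr.
Qed.

Lemma Acomb_delta u : Acomb (fun t => (t == u)%:R) = A u.
Proof.
rewrite /Acomb (bigD1 u) //= eqxx scale1r big1 ?addr0 // => t /negPf ->.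
exact: scale0r.
Qed.

Lemma bracket_AcombAcomb f g :
  bracket (Acomb f) (Acomb g) = 2 *: Gcomb (fun u => \sum_t f (t + u) * g t).
Proof.
rewrite /Acomb /Gcomb bracket_sumr.
transitivity (\sum_t \sum_u (f (t + u) * g t)%:C *: (2 *: G u)).
  apply: eq_bigr => t _; rewrite bracketZr bracket_suml.
  rewrite (reindex_inj (addrI t)) scaler_sumr; apply: eq_bigr => u _.
  by rewrite bracketZl AA addrAC subrr add0r scalerA -realcM mulrC.
rewrite exchange_big scaler_sumr /=; apply: eq_bigr => u _.
by rewrite realc_sum scaler_suml scaler_sumr; apply: eq_bigr => t _; rewrite !scalerA mulrC.
Qed.

Lemma bracket_AcombGcomb f g :
  bracket (Acomb f) (Gcomb g) =
  4 *: Acomb (fun u => \sum_r (f (u - r) - f (u + r)) * g r).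
Proof.
rewrite /Gcomb bracket_sumr.
transitivity (\sum_r \sum_u ((f (u - r) - f (u + r)) * g r)%:C *: (4 *: A u)).
  apply: eq_bigr => r _; rewrite bracketZr /Acomb bracket_suml.
  have -> : \sum_t bracket ((f t)%:C *: A t) (G r) =
     \sum_u (f (u - r))%:C *: (4 *: A u) - \sum_u (f (u + r))%:C *: (4 *: A u).
    rewrite [X in _ = X - _](reindex_inj (addIr r)).
    rewrite [X in _ = _ - X](reindex_inj (addIr (- r))) /= -sumrB.
    by apply: eq_bigr => t _; rewrite bracketZl AG addrK subrK -scalerBr -scalerBr.
  rewrite -sumrB scaler_sumr; apply: eq_bigr => u _.
  by rewrite [in RHS]mulrC realcM -[RHS]scalerA realcB scalerBl.
rewrite exchange_big scaler_sumr /=; apply: eq_bigr => u _.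
by rewrite realc_sum scaler_suml scaler_sumr; apply: eq_bigr => t _; rewrite !scalerA mulrC.
Qed.

(** The hypothesis means that f depends only on the parity of its argument, as the waves of
    frequency 0 and n do; the correlation of f with a delta is then even in the lag. *)
Lemma bracket_Acomb_sym f s : (forall t u, f (t + u) = f (t - u)) ->
  bracket (Acomb f) (A s) = 0.
Proof.
move=> fs; rewrite -Acomb_delta bracket_AcombAcomb Gcomb_even ?scaler0 // => u.
by apply: eq_bigr => t _; rewrite fs opprK.
Qed.

Section Modes.
Local Notation cosZ := (@cosZ R n).
Local Notation sinZ := (@sinZ R n).

(** Measuring the phase from t = 1 puts A_1, the generator ZZ, in the span of cosine modes alone.
    Since sine and [G] are both odd, the sum in [modeZ] counts every term twice, hence 4n there
    against 2n here. *)
Definition modeX (k : I) : Mx := ((2 * n%:R)^-1)%:C *: Acomb (fun t => sinZ (k * (t - 1))).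
Definition modeY (k : I) : Mx := ((2 * n%:R)^-1)%:C *: Acomb (fun t => cosZ (k * (t - 1))).
Definition modeZ (k : I) : Mx := ((4 * n%:R)^-1)%:C *: Gcomb (fun r => sinZ (k * r)).

Let n_neq0 : n%:R != 0 :> R. Proof. by rewrite pnatr_eq0 -lt0n. Qed.

Lemma shift_corr (f g : I -> R) u :
  \sum_t f (t + u - 1) * g (t - 1) = \sum_t f (t + u) * g t.
Proof.
rewrite [RHS](reindex_inj (addIr (-1))) /=; apply: eq_bigr => t _.
by rewrite addrAC.
Qed.

(** The correlation of two sine waves at lag v is cos (k v) times a constant, hence even in v, also
    when k = l. *)
Lemma bracket_modeXX k l : k + l != 0 -> bracket (modeX k) (modeX l) = 0.
Proof.
move=> kl; rewrite bracketZl bracketZr bracket_AcombAcomb Gcomb_even ?scaler0 // => u.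
have E v : \sum_t sinZ (k * (t + v - 1)) * sinZ (l * (t - 1)) =
    cosZ (k * v) * \sum_t sinZ (k * t) * sinZ (l * t).
  transitivity (cosZ (k * v) * (\sum_t sinZ (k * t) * sinZ (l * t))
     + sinZ (k * v) * \sum_t sinZ (l * t) * cosZ (k * t)).
    rewrite (shift_corr (fun t => sinZ (k * t)) (fun t => sinZ (l * t)) v).
    rewrite !mulr_sumr -big_split; apply: eq_bigr => t _ /=.
    by rewrite mulrDr sinZD //; ring.
  by rewrite sum_sin_cos // mulr0 addr0.
by rewrite !E mulrN cosZN.
Qed.

Lemma bracket_modeYY k l : k + l != 0 -> bracket (modeY k) (modeY l) = 0.
Proof.
move=> kl; rewrite bracketZl bracketZr bracket_AcombAcomb Gcomb_even ?scaler0 // => u.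
have E v : \sum_t cosZ (k * (t + v - 1)) * cosZ (l * (t - 1)) =
    cosZ (k * v) * \sum_t cosZ (k * t) * cosZ (l * t).
  transitivity (cosZ (k * v) * (\sum_t cosZ (k * t) * cosZ (l * t))
     - sinZ (k * v) * \sum_t sinZ (k * t) * cosZ (l * t)).
    rewrite (shift_corr (fun t => cosZ (k * t)) (fun t => cosZ (l * t)) v).
    rewrite !mulr_sumr -sumrB; apply: eq_bigr => t _ /=.
    by rewrite mulrDr cosZD //; ring.
  by rewrite sum_sin_cos // mulr0 subr0.
by rewrite !E mulrN cosZN.
Qed.

(** For k = l the correlation at lag u is n sin (k u), and 2 n / (2n)^2 = 2 / (4n): this fixes the
    normalisation of [modeZ]. *)
Lemma bracket_modeXY k l : k + l != 0 ->
  bracket (modeX k) (modeY l) = if k == l then 2 *: modeZ k else 0.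
Proof.
move=> kl; rewrite bracketZl bracketZr bracket_AcombAcomb.
rewrite (@eq_Gcomb _ (fun u => (if k == l then n%:R else 0) * sinZ (k * u))); last first.
  move=> u; rewrite (shift_corr (fun t => sinZ (k * t)) (fun t => cosZ (l * t))).
  transitivity ((\sum_t cosZ (k * t) * cosZ (l * t)) * sinZ (k * u)
     + cosZ (k * u) * \sum_t sinZ (k * t) * cosZ (l * t)).
    rewrite mulr_sumr mulr_suml -big_split; apply: eq_bigr => t _ /=.
    by rewrite mulrDr sinZD //; ring.
  by rewrite sum_sin_cos // mulr0 addr0 sum_cos_cos.
rewrite GcombZ; case: eqP => _; last by rewrite scale0r !scaler0.
rewrite /modeZ -[2 : R[i]]realc2 !scalerA -!realcM; congr (_%:C *: _).
by field.
Qed.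

Lemma bracket_modeXZ k l : k + l != 0 ->
  bracket (modeX k) (modeZ l) = if k == l then - (2 *: modeY k) else 0.
Proof.
move=> kl; rewrite bracketZl bracketZr bracket_AcombGcomb.
rewrite (@eq_Acomb _
  (fun u => (-2 * (if k == l then n%:R else 0)) * cosZ (k * (u - 1)))); last first.
  move=> u; rewrite -sum_sin_sin // mulr_sumr mulr_suml; apply: eq_bigr => r _.
  rewrite (_ : k * (u - r - 1) = k * (u - 1) - k * r); last by ring.
  rewrite (_ : k * (u + r - 1) = k * (u - 1) + k * r); last by ring.
  by rewrite !sinZD // sinZN // cosZN //; ring.
rewrite AcombZ; case: eqP => _; last by rewrite mulr0 scale0r !scaler0.
rewrite /modeY -[2 : R[i]]realc2 -[4 : R[i]](realc_nat R 4) -scaleNr -realcN.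
rewrite !scalerA -!realcM; congr (_%:C *: _).
by field.
Qed.

Lemma bracket_modeYZ k l : k + l != 0 ->
  bracket (modeY k) (modeZ l) = if k == l then 2 *: modeX k else 0.
Proof.
move=> kl; rewrite bracketZl bracketZr bracket_AcombGcomb.
rewrite (@eq_Acomb _
  (fun u => (2 * (if k == l then n%:R else 0)) * sinZ (k * (u - 1)))); last first.
  move=> u; rewrite -sum_sin_sin // mulr_sumr mulr_suml; apply: eq_bigr => r _.
  rewrite (_ : k * (u - r - 1) = k * (u - 1) - k * r); last by ring.
  rewrite (_ : k * (u + r - 1) = k * (u - 1) + k * r); last by ring.
  by rewrite !cosZD // sinZN // cosZN //; ring.
rewrite AcombZ; case: eqP => _; last by rewrite mulr0 scale0r !scaler0.
rewrite /modeX -[2 : R[i]]realc2 -[4 : R[i]](realc_nat R 4) !scalerA -!realcM; congr (_%:C *: _).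
by field.
Qed.

Lemma mode_triple k : k + k != 0 -> su2_triple (modeX k) (modeY k) (modeZ k).
Proof.
move=> kk; split; rewrite ?bracket_modeXY ?bracket_modeYZ ?eqxx //.
by rewrite bracketC bracket_modeXZ // eqxx opprK.
Qed.

(* Jacobi: [2 *: modeZ k] is the bracket of [modeX k] and [modeY k]. *)
Lemma bracket_modeZZ k l : k + k != 0 -> k + l != 0 -> k != l ->
  bracket (modeZ k) (modeZ l) = 0.
Proof.
move=> kk kl nkl; have two : (2 : R[i]) != 0 by rewrite pnatr_eq0.
apply: (scalerI two); rewrite -bracketZl scaler0.
have [<- _ _] := mode_triple kk.
rewrite bracketC jacobi.
rewrite (bracketC (modeZ l)) bracket_modeXZ // (negPf nkl) oppr0 bracket0l add0r.
by rewrite (bracketC (modeZ l)) bracket_modeYZ // (negPf nkl) oppr0 bracket0r oppr0.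
Qed.

Lemma bracket_comb3_eq0 x y z a b c (D : Mx) :
  bracket x D = 0 -> bracket y D = 0 -> bracket z D = 0 ->
  bracket (comb3 x y z a b c) D = 0.
Proof.
by move=> xD yD zD; rewrite /comb3 !bracketDl !bracketZl xD yD zD !scaler0 !addr0.
Qed.

Lemma mode_span_comm k l B D : k + k != 0 -> k + l != 0 -> k != l ->
  span3 (modeX k) (modeY k) (modeZ k) B -> span3 (modeX l) (modeY l) (modeZ l) D ->
  bracket B D = 0.
Proof.
move=> kk kl nkl [a [b [c ->]]] [a' [b' [c' ->]]].
have nlk : l != k by rewrite eq_sym.
have lk : l + k != 0 by rewrite addrC.
have E : forall x, [\/ x = modeX k, x = modeY k | x = modeZ k] ->
    bracket x (comb3 (modeX l) (modeY l) (modeZ l) a' b' c') = 0.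
  move=> x xk; rewrite bracketC; apply/eqP; rewrite oppr_eq0; apply/eqP.
  apply: bracket_comb3_eq0; rewrite bracketC; apply/eqP; rewrite oppr_eq0; apply/eqP;
  case: xk => ->.
  - exact: bracket_modeXX.
  - by rewrite bracketC (bracket_modeXY lk) (negPf nlk) oppr0.
  - by rewrite bracketC (bracket_modeXZ lk) (negPf nlk) oppr0.
  - by rewrite (bracket_modeXY kl) (negPf nkl).
  - exact: bracket_modeYY.
  - by rewrite bracketC (bracket_modeYZ lk) (negPf nlk) oppr0.
  - by rewrite (bracket_modeXZ kl) (negPf nkl).
  - by rewrite (bracket_modeYZ kl) (negPf nkl).
  - exact: bracket_modeZZ.
by apply: bracket_comb3_eq0; apply: E; [constructor 1|constructor 2|constructor 3].
Qed.

(** Summed over all 2n frequencies k, the cosines of k (t - u) give 2n times the delta at t = u;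
    writing t - u as (t - 1) - (u - 1) brings in the modes. *)
Lemma fourier_inversion u : A u = (n.*2%:R^-1)%:C *:
  \sum_k ((cosZ (k * (u - 1)))%:C *: Acomb (fun t => cosZ (k * (t - 1)))
        + (sinZ (k * (u - 1)))%:C *: Acomb (fun t => sinZ (k * (t - 1)))).
Proof.
have n2 : n.*2%:R != 0 :> R by rewrite pnatr_eq0 double_eq0 -lt0n.
transitivity ((n.*2%:R^-1)%:C *: Acomb (fun t => \sum_k cosZ (k * (t - u)))).
  rewrite -AcombZ -[LHS]Acomb_delta; apply: eq_Acomb => t.
  under eq_bigr do rewrite mulrC.
  by rewrite sum_cosZ // subr_eq0; case: eqP => _; rewrite ?mulr0 // mulVf.
congr (_ *: _).
transitivity (\sum_k \sum_t (cosZ (k * (t - u)))%:C *: A t).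
  rewrite exchange_big; apply: eq_bigr => t _ /=.
  by rewrite realc_sum scaler_suml.
apply: eq_bigr => k _; rewrite -!AcombZ /Acomb -big_split; apply: eq_bigr => t _ /=.
rewrite -scalerDl -realcD; congr (_%:C *: _).
rewrite (_ : k * (t - u) = k * (t - 1) - k * (u - 1)); last by ring.
by rewrite cosZD // cosZN // sinZN //; ring.
Qed.

End Modes.
End Onsager.

Lemma sum_ord3 (V : nmodType) (F : 'I_3 -> V) : \sum_j F j = F 0 + F 1 + F 2%:R.
Proof.
rewrite !big_ord_recl big_ord0 addr0 addrA.
by congr (_ + _ + _); congr (F _); apply: val_inj.
Qed.

Lemma sum_comb3 (R : realType) N (x y z : 'M[R[i]]_N) (c : 'I_3 -> R) :
  \sum_j (c j)%:C *: [:: x; y; z]`_j = comb3 x y z (c 0) (c 1) (c 2%:R).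
Proof. exact: sum_ord3. Qed.

(** * Structure of the Lie algebra generated by - A_0 and A_1 *)

Section Structure.
Variables (R : realType) (n N : nat).
Hypothesis n_gt0 : (0 < n)%N.
Local Notation I := 'Z_(n.*2).
Local Notation Mx := 'M[R[i]]_N.
Variables A G : I -> Mx.
Hypothesis AA : forall s t, bracket (A s) (A t) = 2 *: G (s - t).
Hypothesis AG : forall t r, bracket (A t) (G r) = 4 *: (A (t + r) - A (t - r)).
Hypothesis GN : forall r, G (- r) = - G r.

Definition mode (k : 'I_n.-1) : I := k.+1%:R.

Let mode_lt (k : 'I_n.-1) : (k.+1 < n)%N.
Proof. by rewrite -[X in (_ < X)%N](prednK n_gt0) ltnS. Qed.

Lemma modeD_neq0 k l : mode k + mode l != 0.
Proof.
rewrite /mode -natrD -[0]/(0%:R) natZ_eq // -?addnn; last by rewrite addn_gt0 n_gt0.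
by apply: (ltn_trans (n := n + l.+1)); rewrite ?ltn_add2r ?ltn_add2l mode_lt.
Qed.

Lemma mode_inj k l : k != l -> mode k != mode l.
Proof.
have lt2 (j : 'I_n.-1) : (j.+1 < n.*2)%N by rewrite -addnn ltn_addr.
by rewrite /mode natZ_eq // eqSS.
Qed.

Local Notation X k := (modeX A (mode k)).
Local Notation Y k := (modeY A (mode k)).
Local Notation Z k := (modeZ G (mode k)).
Hypothesis Y_neq0 : forall k, Y k <> 0.

Definition onsager := lie_generated [set - A 0; A 1].
Definition simple_part k := span3 (X k) (Y k) (Z k).

Let T k : su2_triple (X k) (Y k) (Z k) := mode_triple n_gt0 AA AG (modeD_neq0 k k).
Let g_alg : lie_subalgebra onsager := @lie_generated_subalgebra R N _.
Let g_sub : real_subspace onsager := g_alg.1.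
Let g_bracket B D : onsager B -> onsager D -> onsager (bracket B D) := @g_alg.2 B D.

Lemma onsager_gen B : [set - A 0; A 1] B -> onsager B.
Proof. by move=> SB h [_]; apply. Qed.

(** [G 1] is half the bracket of A_1 and A_0, and bracketing with it yields A_(m+2) from A_(m+1) and
    A_m; counting upwards reaches all of Z/2n. *)
Lemma onsager_A t : onsager (A t).
Proof.
have g0 : onsager (A 0).
  by rewrite -[A 0]opprK; apply: (subspaceN g_sub); apply: onsager_gen; left.
have g1 : onsager (A 1) by apply: onsager_gen; right.
have two : (2 : R[i]) != 0 by rewrite pnatr_eq0.
have four : (4 : R[i]) != 0 by rewrite pnatr_eq0.
have gG : onsager (G 1).
  have : onsager (2^-1 *: bracket (A 1) (A 0)).
    by apply: (subspaceZ_natV g_sub); exact: g_bracket.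
  by rewrite AA subr0 scalerA mulVf // scale1r.
suff H m : onsager (A m%:R) /\ onsager (A m.+1%:R).
  by rewrite -(natr_Zp t); have [] := H t.
elim: m => [|m [IH0 IH1]]; first by split.
split=> //.
have : onsager (4^-1 *: bracket (A m.+1%:R) (G 1) + A m%:R).
  apply: (subspaceD g_sub) => //; apply: (subspaceZ_natV g_sub); exact: g_bracket.
rewrite AG scalerA mulVf // scale1r.
have -> : m.+1%:R + 1 = m.+2%:R :> I by rewrite natr1.
have -> : m.+1%:R - 1 = m%:R :> I by rewrite -natr1 addrK.
by rewrite subrK.
Qed.

Lemma onsager_G r : onsager (G r).
Proof.
have two : (2 : R[i]) != 0 by rewrite pnatr_eq0.
have : onsager (2^-1 *: bracket (A r) (A 0)).
  by apply: (subspaceZ_natV g_sub); apply: g_bracket; exact: onsager_A.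
by rewrite AA subr0 scalerA mulVf // scale1r.
Qed.

Lemma onsager_Acomb f : onsager (Acomb A f).
Proof.
apply: (subspace_bigsum g_sub) => t _; apply: (subspaceZ g_sub); exact: onsager_A.
Qed.

Lemma onsager_Gcomb f : onsager (Gcomb G f).
Proof.
apply: (subspace_bigsum g_sub) => t _; apply: (subspaceZ g_sub); exact: onsager_G.
Qed.

Lemma simple_part_sub k : simple_part k `<=` onsager.
Proof.
move=> _ [a [b [c ->]]]; rewrite /comb3.
have [gX gY gZ] : [/\ onsager (X k), onsager (Y k) & onsager (Z k)].
  split; apply: (subspaceZ g_sub); [exact: onsager_Acomb|exact: onsager_Acomb|exact: onsager_Gcomb].
by apply: (subspaceD g_sub); [apply: (subspaceD g_sub)|]; apply: (subspaceZ g_sub).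
Qed.

Lemma center_Acomb f : (forall t u, f (t + u) = f (t - u)) ->
  lie_center onsager (Acomb A f).
Proof.
move=> fs; split; first exact: onsager_Acomb.
have C t : bracket (Acomb A f) (A t) = 0 := bracket_Acomb_sym AA GN t fs.
(* By Jacobi the matrices commuting with [Acomb A f] form a Lie subalgebra, so testing the two
   generators is enough. *)
move=> B gB; apply: (gB [set D | bracket (Acomb A f) D = 0]); split.
  split; first split.
  - exact: bracket0r.
  - by move=> a D E cD cE; rewrite /= bracketDr bracketZr cD cE scaler0 addr0.
  - by move=> D E cD cE; rewrite /= jacobi cD cE bracket0l bracket0r addr0.
by move=> D [->|->] /=; rewrite ?bracketNr C ?oppr0.
Qed.

Definition summand (o : option 'I_n.-1) : set Mx :=
  if o is Some k then simple_part k else lie_center onsager.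

Lemma summand_subspace o : real_subspace (summand o).
Proof.
by case: o => [k|]; [exact: span3_subspace | exact: lie_center_subspace].
Qed.

Lemma summand_sub o : summand o `<=` onsager.
Proof. by case: o => [k|]; [exact: simple_part_sub | move=> B []]. Qed.

Lemma summand_bracket o B D : summand o B -> summand o D -> summand o (bracket B D).
Proof.
case: o => [k|]; first exact: span3_bracket.
by move=> [gB cB] [gD cD]; rewrite cB //; exact: (subspace0 (lie_center_subspace g_sub)).
Qed.

Lemma summand_comm o o' B D : o != o' -> summand o B -> summand o' D -> bracket B D = 0.
Proof.
case: o o' => [k|] [l|] //=.
- move=> kl; apply: (mode_span_comm n_gt0 AA AG GN (modeD_neq0 k k) (modeD_neq0 k l)).
  exact: mode_inj.
- by move=> _ Bk [_ cD]; rewrite bracketC cD ?oppr0 //; exact: simple_part_sub Bk.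
- by move=> _ [_ cB] Dl; rewrite cB //; exact: simple_part_sub Dl.
Qed.

Let S := subspace_sum summand.
Let S_sub : real_subspace S := subspace_sum_subspace summand_subspace.

(* The modes 0 and [half n] are the central ones; [- mode j] gives [mode j] up
   to sign. *)
Lemma mode_cases (k : I) : [\/ k = 0, k = half n, exists j, k = mode j | exists j, k = - mode j].
Proof.
have n2 : (1 < n.*2)%N by rewrite -addnn -(addn1 1) leq_add.
have small p : (0 < p < n)%N -> exists j, p%:R = mode j.
  case/andP => p0 pn; have pn' : (p.-1 < n.-1)%N by rewrite -ltnS !prednK.
  by exists (Ordinal pn'); rewrite /mode /= prednK.
have [m mn [->|->]] := half_split n_gt0 k; (case: (posnP m) => [->|m0]).
- by constructor 1.
- by constructor 3; apply: small; rewrite m0.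
- by constructor 2; rewrite add0r.
- constructor 4; have [j jE] : exists j, (n - m)%:R = mode j.
    by apply: small; rewrite subn_gt0 mn /= -{2}[n]subn0 ltn_sub2l.
  exists j; rewrite -jE natrB 1?ltnW // opprB /half; congr (_ + _).
  by apply/eqP; rewrite eq_sym eqr_oppLR -addr_eq0 -natrD addnn double_n_eq0.
Qed.

Let mode_sum k : span3 (X k) (Y k) (Z k) `<=` S.
Proof. exact: (@sub_subspace_sum _ _ _ summand summand_subspace (Some k)). Qed.

Let center_sum : lie_center onsager `<=` S.
Proof. exact: (@sub_subspace_sum _ _ _ summand summand_subspace None). Qed.

Local Notation cosZ := (@cosZ R n).
Local Notation sinZ := (@sinZ R n).

Let cos_sum k : S (Acomb A (fun t => cosZ (mode k * (t - 1)))).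
Proof.
have c0 : (2 * n%:R)^-1 != 0 :> R by rewrite invr_eq0 mulf_neq0 ?pnatr_eq0 -?lt0n.
have : S ((2 * n%:R)%:C *: Y k).
  by apply: (subspaceZ S_sub); apply: mode_sum; exact: span3_snd.
by rewrite /modeY scalerA -realcM mulfV ?scale1r // -invr_eq0.
Qed.

Let sin_sum k : S (Acomb A (fun t => sinZ (mode k * (t - 1)))).
Proof.
have c0 : (2 * n%:R)^-1 != 0 :> R by rewrite invr_eq0 mulf_neq0 ?pnatr_eq0 -?lt0n.
have : S ((2 * n%:R)%:C *: X k).
  by apply: (subspaceZ S_sub); apply: mode_sum; exact: span3_fst.
by rewrite /modeX scalerA -realcM mulfV ?scale1r // -invr_eq0.
Qed.

Lemma A_in_sum u : S (A u).
Proof.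
rewrite (fourier_inversion n_gt0 A u); apply: (subspaceZ S_sub).
apply: (subspace_bigsum S_sub) => k _.
(* [half n * x] is its own opposite: hence the sines of frequency n vanish, and reflections preserve
   the cosine mode, as [center_Acomb] requires. *)
have dbl (x : I) : half n * x = half n * (- x).
  by apply/eqP; rewrite mulrN -addr_eq0 -mulrDl (half_half n_gt0) mul0r.
have sin_half x : sinZ (half n * x) = 0.
  have /eqP : sinZ (half n * x) = - sinZ (half n * x) by rewrite {1}dbl mulrN sinZN.
  by rewrite -addr_eq0 -mulr2n mulrn_eq0 => /eqP.
apply: (subspaceD S_sub); apply: (subspaceZ S_sub); case: (mode_cases k) => [->|->|[j ->]|[j ->]].
- by apply: center_sum; apply: center_Acomb => t v; rewrite !mul0r.
- apply: center_sum; apply: center_Acomb => t v.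
  rewrite -!addrA !mulrDr (dbl v) -!mulrDr //.
- exact: cos_sum.
- rewrite (@eq_Acomb _ _ _ _ _ (fun t => cosZ (mode j * (t - 1)))) //.
  by move=> t; rewrite mulNr cosZN.
- by apply: center_sum; apply: center_Acomb => t v; rewrite !mul0r.
- by apply: center_sum; apply: center_Acomb => t v; rewrite !sin_half.
- exact: sin_sum.
- rewrite (@eq_Acomb _ _ _ _ _ (fun t => -1 * sinZ (mode j * (t - 1)))).
    by rewrite AcombZ; apply: (subspaceZ S_sub).
  by move=> t; rewrite (mulNr (mode j)) sinZN // mulN1r.
Qed.

Lemma onsagerE : onsager = S.
Proof.
apply/seteqP; split=> B; last first.
  by apply: subspace_sum_min => // o; exact: summand_sub.
move=> gB; apply: gB; split.
  exact: (subspace_sum_lie summand_subspace summand_bracket summand_comm).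
move=> D [->|->]; last exact: A_in_sum.
by apply: (subspaceN S_sub); exact: A_in_sum.
Qed.

Let simple_sub k : real_subspace (simple_part k) := summand_subspace (Some k).
Let simple_comm k l B D : k != l -> simple_part k B -> simple_part l D -> bracket B D = 0.
Proof. by move=> kl; exact: (@summand_comm (Some k) (Some l)). Qed.

Lemma simple_centerless k B : simple_part k B ->
  (forall D, simple_part k D -> bracket B D = 0) -> B = 0.
Proof. exact: su2_centerless (T k) (@Y_neq0 k). Qed.

Lemma onsager_direct : is_direct_sum onsager summand.
Proof.
split; first exact: onsagerE.
move=> u uU u0.
have us k : u (Some k) = 0.
  exact: (sum_eq0_component (i := Some k) summand_comm uU u0 (@simple_centerless k)).
case=> [k|]; first exact: us.
(* With the su(2) components gone, the vanishing sum is the central component itself, which no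
   bracket could detect. *)
rewrite -[RHS]u0 (bigD1 None) //= big1 ?addr0 // => -[k|] //.
Qed.

Lemma simple_ideal k : lie_ideal (simple_part k) onsager.
Proof.
split; [exact: simple_sub | exact: simple_part_sub |].
rewrite onsagerE => _ D [u [uU ->]] Dk.
rewrite (bracket_sum_one summand_comm (i := Some k) uU Dk).
exact: (@summand_bracket (Some k)).
Qed.

(** Central components drop out of every bracket, and each su(2) part is spanned by its own
    brackets, such as X = 1/2 [Y, Z]. *)
Lemma derived_direct : is_direct_sum (derived_algebra onsager) simple_part.
Proof.
have sumS : real_subspace (subspace_sum simple_part).
  exact: subspace_sum_subspace simple_sub.
split; last first.
  move=> u uU u0 k.
  exact: (sum_eq0_component (i := k) simple_comm uU u0 (@simple_centerless k)).
apply/seteqP; split=> B.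
  move=> dB; apply: dB; split=> // _ [D + [E + <-]].
  rewrite onsagerE => -[u [uU ->]] [v [vU ->]].
  rewrite (bracket_sum_sum summand_comm uU vU).
  apply: (subspace_bigsum sumS) => -[k|] _.
    apply: (@sub_subspace_sum _ _ _ simple_part simple_sub k).
    exact: (@summand_bracket (Some k) _ _ (uU (Some k)) (vU (Some k))).
  have [_ ->] := uU None; first exact: (subspace0 sumS).
  by have [] := vU None.
apply: subspace_sum_min; first exact: real_span_subspace.
move=> k D Dk h [hsub hb].
have two : (2 : R[i]) != 0 by rewrite pnatr_eq0.
have [XY YZ ZX] := T k.
have mem U V W : simple_part k U -> simple_part k V -> bracket U V = 2 *: W -> h W.
  move=> kU kV e; have : h (2^-1 *: bracket U V).
    apply: (subspaceZ_natV hsub); apply: hb; exists U; first exact: simple_part_sub kU.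
    by exists V => //; exact: simple_part_sub kV.
  by rewrite e scalerA mulVf // scale1r.
have [sX sY sZ] : [/\ simple_part k (X k), simple_part k (Y k) & simple_part k (Z k)].
  by split; [exact: span3_fst|exact: span3_snd|exact: span3_trd].
have hX : h (X k) := mem _ _ _ sY sZ YZ.
have hY : h (Y k) := mem _ _ _ sZ sX ZX.
have hZ : h (Z k) := mem _ _ _ sX sY XY.
case: Dk => [a [b [c ->]]].
by apply: (subspaceD hsub); [apply: (subspaceD hsub)|]; apply: (subspaceZ hsub).
Qed.

Lemma mode_canonical :
  canonical_basis simple_part (fun k => X k) (fun k => Y k) (fun k => Z k).
Proof.
have sumE (c : 'I_n.-1 * 'I_3 -> R) :
    \sum_p (c p)%:C *: [:: X p.1; Y p.1; Z p.1]`_(p.2) =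
    \sum_k comb3 (X k) (Y k) (Z k) (c (k, 0)) (c (k, 1)) (c (k, 2%:R)).
  transitivity (\sum_k \sum_j (c (k, j))%:C *: [:: X k; Y k; Z k]`_j).
    by rewrite pair_bigA; apply: eq_bigr => -[k j] _.
  by apply: eq_bigr => k _; exact: (sum_comb3 _ _ _ (fun j => c (k, j))).
split; last 1 first.
- move=> j k jk x y jx ky; apply: (simple_comm jk).
    by case: jx => [[->|->]|->]; [exact: span3_fst|exact: span3_snd|exact: span3_trd].
  by case: ky => [[->|->]|->]; [exact: span3_fst|exact: span3_snd|exact: span3_trd].
- split.
    apply/seteqP; split=> B.
      move=> [u [uU ->]].
      have /(@choice _ _ _)[c cE] : forall k, exists p : R * R * R,
          u k = comb3 (X k) (Y k) (Z k) p.1.1 p.1.2 p.2.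
        by move=> k; have [a [b [d e]]] := uU k; exists (a, b, d).
      exists (fun p : 'I_n.-1 * 'I_3 => [:: (c p.1).1.1; (c p.1).1.2; (c p.1).2]`_(p.2)).
      by rewrite sumE; apply: eq_bigr => k _; rewrite cE.
    move=> [c ->]; rewrite sumE; eexists; split; last reflexivity.
    by move=> k; do 3!eexists.
  move=> c; rewrite sumE => c0 [k j].
  have /(comb3_free (T k) (@Y_neq0 k))[e0 e1 e2] :
      comb3 (X k) (Y k) (Z k) (c (k, 0)) (c (k, 1)) (c (k, 2%:R)) = 0.
    apply: (sum_eq0_component (i := k) simple_comm _ c0 (@simple_centerless k)).
    by move=> l; do 3!eexists.
  case: j => -[|[|[|//]]] hj; [rewrite -e0|rewrite -e1|rewrite -e2];
    congr (c (k, _)); exact: val_inj.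
- exact: T.
Qed.

Lemma simple_part_iso k : lie_isomorphic (simple_part k) (su R 2).
Proof.
rewrite su2E; apply: su2_iso (T k) (@Y_neq0 k) (sigma_triple R) (@sigmaZ_neq0 R).
Qed.

Theorem onsager_structure :
  [/\ forall k, [/\ lie_ideal (simple_part k) onsager, simple_lie (simple_part k)
                    & lie_isomorphic (simple_part k) (su R 2)],
      is_direct_sum onsager summand,
      is_direct_sum (derived_algebra onsager) simple_part,
      forall k, [/\ simple_part k (X k), simple_part k (Y k) & simple_part k (Z k)]
    & canonical_basis simple_part (fun k => X k) (fun k => Y k) (fun k => Z k)].
Proof.
split; [|exact: onsager_direct|exact: derived_direct| |exact: mode_canonical].
- move=> k; split; [exact: simple_ideal| |exact: simple_part_iso].
  exact: su2_simple (T k) (@Y_neq0 k).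
- by move=> k; split; [exact: span3_fst|exact: span3_snd|exact: span3_trd].
Qed.

End Structure.

(** * Matching the Fourier sums with the formulas of the statement *)

Section CyclicSums.
Variable n : nat.
Hypothesis n_gt0 : (0 < n)%N.
Local Notation I := 'Z_(n.*2).

(** Z/2n is represented by -(n - 1), ..., n, the range in which every A_t is, up to sign, one of the
    symbols of the statement. *)
Lemma sum_Zp_signed (V : nmodType) (F : I -> V) :
  \sum_x F x = \sum_(0 <= j < n) F (- j%:R) + \sum_(0 <= j < n) F j.+1%:R.
Proof.
rewrite (reindex_inj (addIr 1)) /= (sum_Zp n_gt0).
rewrite (@big_cat_nat _ _ _ n) //=; last by rewrite -addnn leq_addr.
rewrite addrC; congr (_ + _); last by apply: eq_bigr => j _; rewrite natr1.
rewrite big_nat_rev /= -{1}[n]add0n big_addn.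
have -> : (n.*2 - n)%N = n by rewrite -addnn addnK.
apply: eq_big_nat => j /andP[_ jn]; congr F.
have -> : (n + n.*2 - (j + n).+1 = n.*2 - j.+1)%N by rewrite -addSn addnC subnDr.
rewrite natr1 -subSn; last by rewrite -addnn ltn_addr.
rewrite subSS natrB; last by rewrite -addnn (leq_trans (ltnW jn)) ?leq_addr.
by rewrite (double_n_eq0 n_gt0) sub0r.
Qed.

Lemma sum_Zp_even (V : nmodType) (F : I -> V) : (forall x, F (- x) = F x) ->
  \sum_x F x = F 0 + \sum_(1 <= j < n) F j%:R + (\sum_(1 <= j < n) F j%:R + F n%:R).
Proof.
move=> Fe; rewrite sum_Zp_signed; congr (_ + _).
  by rewrite big_ltn // oppr0; congr (_ + _); apply: eq_bigr => j _; rewrite Fe.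
by rewrite -(big_add1 _ _ 0 n.+1 xpredT (fun j => F j%:R)) big_nat_recr.
Qed.

End CyclicSums.

(** The layout of [tX] and [tY]: the isolated terms are, up to sign, X, ZZ, X^(n-1) and YX^(n-2)Y,
    and the pair at j is YX^(j-1)Y with ZX^jZ. *)
Lemma sum_Zp_blocks m (V : zmodType) (F : 'Z_(m.+2.*2) -> V) :
  \sum_x F x = F 0 + F 1 + F m.+2%:R + F (- m.+1%:R)
    + \sum_(1 <= j < m.+1) (F (- j%:R) + F j.+1%:R).
Proof.
rewrite (sum_Zp_signed (n := m.+2)) //.
rewrite [X in X + _ = _]big_nat_recr //= [X in X + _ + _ = _]big_ltn //.
rewrite [X in _ + X = _]big_nat_recr //= [X in _ + (X + _) = _]big_ltn //.
rewrite big_split /= oppr0.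
set S1 := \sum_(1 <= i < m.+1) _; set S2 := \sum_(1 <= i < m.+1) _.
by rewrite [LHS](AC ((2*1)*(2*1)) ((1*4*6*3)*(2*5))) /=.
Qed.

Lemma collectX (F : pzRingType) (V : lmodType F) (s t : F) (x y a b S S' : V) :
  - S = S' -> s *: (- x) - S + t *: y = (- s) *: x + 0 *: a + t *: y + 0 *: b + S'.
Proof. by move=> <-; rewrite !scale0r !addr0 scalerN scaleNr addrAC. Qed.

Lemma collectY (F : pzRingType) (V : lmodType F) (s t u : F) (x y z a S S' : V) :
  S = S' -> - s *: (- x) + u *: z + t *: y + a + S = s *: x + 1 *: a + t *: y + u *: z + S'.
Proof.
move=> <-; rewrite scalerN scaleNr opprK scale1r; congr (_ + _).
by rewrite [LHS](AC 4 (1*4*3*2)).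
Qed.

Lemma inv_double (F : numFieldType) (x : F) : x != 0 -> (2 * x)^-1 = (4 * x)^-1 + (4 * x)^-1.
Proof. by move=> x0; field. Qed.

Section Main.
Variables (R : realType) (m : nat).
Local Notation n := m.+2.
Local Notation C := R[i].
Local Notation I := 'Z_(n.*2).
Local Notation A := (@onsA R n).
Local Notation G := (@onsG R n).
Let n_gt0 : (0 < n)%N := isT.

Lemma sinZ_mul k j : sinZ R (k%:R * j%:R : I) = sin (k%:R * j%:R * pi / n%:R).
Proof. by rewrite (_ : k%:R * j%:R = (k * j)%:R :> I) -?natrM // (sinZ_nat R n_gt0) natrM. Qed.

Lemma cosZ_mul k j : cosZ R (k%:R * j%:R : I) = cos (k%:R * j%:R * pi / n%:R).
Proof. by rewrite (_ : k%:R * j%:R = (k * j)%:R :> I) -?natrM // (cosZ_nat R n_gt0) natrM. Qed.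

Lemma snE k j : sn R n k j = (sinZ R (k%:R * j%:R : I))%:C.
Proof. by rewrite sinZ_mul. Qed.

Lemma csE k j : cs R n k j = (cosZ R (k%:R * j%:R : I))%:C.
Proof. by rewrite cosZ_mul. Qed.

Lemma angle_n k : k%:R * n%:R * pi / n%:R = k%:R * pi :> R.
Proof. by rewrite mulrAC mulfK // pnatr_eq0. Qed.

Lemma sin_natpi k : sin (k%:R * pi : R) = 0.
Proof.
elim: k => [|k IH]; first by rewrite mul0r sin0.
by rewrite -natr1 mulrDl mul1r sinD sinpi cospi IH mul0r mulr0 addr0.
Qed.

Lemma sinZ_kn k : sinZ R (k%:R * n%:R : I) = 0.
Proof. by rewrite sinZ_mul angle_n sin_natpi. Qed.

Lemma cosZ_kn k : cosZ R (k%:R * n%:R : I) = cos (k%:R * pi).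
Proof. by rewrite cosZ_mul angle_n. Qed.

Lemma scaleV2n : (2 * n%:R)^-1 = ((2 * n%:R : R)^-1)%:C :> C.
Proof. by rewrite realcV realcM !realc_nat. Qed.

Lemma mul_predn (k : nat) : k%:R * (n%:R - 1) = k%:R * m.+1%:R :> I.
Proof. by rewrite -[n%:R]natr1 addrK. Qed.

Lemma mul_opp_succ (k j : nat) : k%:R * (- j%:R - 1) = - (k%:R * j.+1%:R) :> I.
Proof. by rewrite -opprD natr1 mulrN. Qed.

Lemma mul_succ_pred (k j : nat) : k%:R * (j.+1%:R - 1) = k%:R * j%:R :> I.
Proof. by rewrite -natr1 addrK. Qed.

Lemma mul_zero_pred (k : nat) : k%:R * (0 - 1) = - (k%:R * 1%:R) :> I.
Proof. by rewrite sub0r mulrN. Qed.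

(** ZZ and YX^(n-2)Y are absent from [tX] because t - 1 is 0 for the one and -n for the other, where
    the sine vanishes for every k. *)
Lemma tX_mode k : tX R n k = modeX A k%:R.
Proof.
rewrite /tX /modeX scaleV2n; congr (_ *: _).
rewrite /Acomb sum_Zp_blocks.
have -> : sinZ R (k%:R * (0 - 1) : I) = - sinZ R (k%:R * 1%:R : I).
  by rewrite mul_zero_pred sinZN.
have -> : sinZ R (k%:R * (1 - 1) : I) = 0 by rewrite subrr mulr0 sinZ0.
have -> : sinZ R (k%:R * (- m.+1%:R - 1) : I) = 0.
  by rewrite mul_opp_succ sinZN // sinZ_kn oppr0.
rewrite mul_predn realcN !snE symX_ons // symXn1_ons //.
apply: collectX; rewrite -sumrN; apply: eq_big_nat => j /andP[j0 jm].
rewrite mul_opp_succ mul_succ_pred sinZN // realcN scaleNr.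
have jn : (j.-1.+1 < n)%N by rewrite prednK // ltnS ltnW.
by rewrite !snE opprB symZXZ_ons // (symYXY_ons R n_gt0 jn) (prednK j0) addrC.
Qed.

Lemma tY_mode k : tY R n k = modeY A k%:R.
Proof.
rewrite /tY /modeY scaleV2n -scalerDr; congr (_ *: _).
rewrite /Acomb sum_Zp_blocks.
have -> : cosZ R (k%:R * (0 - 1) : I) = cosZ R (k%:R * 1%:R : I).
  by rewrite mul_zero_pred cosZN.
have -> : cosZ R (k%:R * (1 - 1) : I) = 1 by rewrite subrr mulr0 cosZ0.
have -> : cosZ R (k%:R * (- m.+1%:R - 1) : I) = cos (k%:R * pi).
  by rewrite mul_opp_succ cosZN // cosZ_kn.
have tn : (m.+1 < n)%N by [].
have -> : (n - 2)%N = m by rewrite subn2.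
rewrite mul_predn !csE (symX_ons R n_gt0) (symXn1_ons R n_gt0) (symZXZ_ons R n_gt0 0).
rewrite (symYXY_ons R n_gt0 tn).
apply: collectY; apply: eq_big_nat => j /andP[j0 jm].
have jn : (j.-1.+1 < n)%N by rewrite prednK // ltnS ltnW.
rewrite mul_opp_succ mul_succ_pred (cosZN _ n_gt0).
by rewrite !csE (symZXZ_ons R n_gt0) (symYXY_ons R n_gt0 jn) (prednK j0).
Qed.

Lemma scaleNN (F : pzRingType) (V : lmodType F) (a : F) (x : V) : (- a) *: (- x) = a *: x.
Proof. by rewrite scaleNr scalerN opprK. Qed.

Lemma sinG_even (k r : I) : (sinZ R (k * - r))%:C *: G (- r) = (sinZ R (k * r))%:C *: G r.
Proof. by rewrite mulrN (sinZN _ n_gt0) (onsG_N R n_gt0) realcN; exact: scaleNN. Qed.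

Lemma collectZ (F : pzRingType) (V : lmodType F) (a b : F) (x y S S' : V) :
  b = a + a -> S = S' -> b *: S = a *: (0 *: x + S' + (S' + 0 *: y)).
Proof. by move=> -> ->; rewrite !scale0r add0r addr0 scalerDr scalerDl. Qed.

(** The terms r and -r agree and those at 0 and n vanish, so the sum folds to twice the sum over 0 <
    r < n; this turns 1/4n into 1/2n. *)
Lemma tZ_mode k : tZ R n k = modeZ G k%:R.
Proof.
rewrite /tZ /modeZ /Gcomb (sum_Zp_even n_gt0 (sinG_even k%:R)) scaleV2n.
have -> : sinZ R (k%:R * 0 : I) = 0 by rewrite mulr0 sinZ0.
rewrite sinZ_kn; apply: collectZ.
  by rewrite -realcD; congr (_%:C); apply: inv_double; rewrite pnatr_eq0.
apply: eq_big_nat => j /andP[j0 jn]; rewrite snE.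
by rewrite (symYXZ_ons R n_gt0) (prednK j0).
Qed.

End Main.

(** * Non-vanishing of the modes *)

(* In the diagonal entry at the basis vector fixed by every [Z j], a Pauli string
   anticommuting with some [Z j] vanishes; of the terms of [tY] only [ZZ] survives. *)
Section NonVanishing.
Variables (R : realType) (m : nat).
Local Notation n := m.+3.
Local Notation C := R[i].
Local Notation Mx := 'M[C]_(2 ^ n).
Let n_gt0 : (0 < n)%N := isT.
Local Notation X := (pX R n).
Local Notation Y := (pY R n).
Local Notation Z := (pZ R n).

Definition anti_Z j (M : Mx) := Z j *m M = - (M *m Z j).
Definition comm_Z j (M : Mx) := Z j *m M = M *m Z j.

Lemma anti_comm_Z j M M' : anti_Z j M -> comm_Z j M' -> anti_Z j (M *m M').
Proof. by move=> aM cM; rewrite /anti_Z mulmxA aM mulNmx -!mulmxA cM. Qed.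

Lemma comm_anti_Z j M M' : comm_Z j M -> anti_Z j M' -> anti_Z j (M *m M').
Proof. by move=> cM aM; rewrite /anti_Z mulmxA cM -mulmxA aM mulmxN mulmxA. Qed.

Lemma anti_Z_X j : anti_Z j (X j).
Proof. by rewrite /anti_Z (on_qubit_anti n_gt0 _ _ (sigmaZX_anti R)) eqxx. Qed.

Lemma anti_Z_Y j : anti_Z j (Y j).
Proof. by rewrite /anti_Z (on_qubit_anti n_gt0 _ _ (sigmaZY_anti R)) eqxx. Qed.

Lemma comm_Z_Y j d : (0 < d < n)%N -> comm_Z j (Y (j + d)).
Proof.
case/andP => d0 dn; apply: on_qubit_comm; rewrite eq_sym.
by have := @modn_add_neq n j d 0 d0 dn; rewrite !addn0.
Qed.

Lemma comm_Z_Z j k : comm_Z j (Z k).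
Proof. exact: on_qubit_selfC. Qed.

Lemma comm_Z_Xrun j t : (t < n)%N -> comm_Z j (Xrun R n j t).
Proof.
move=> tn; rewrite /comm_Z; apply: Xrun_comm => // l /andP[l0 lt].
by have := @modn_add_neq n j l 0 l0 (leq_ltn_trans lt tn); rewrite addn0.
Qed.

Lemma anti_Z_YXY j t : (t.+1 < n)%N -> anti_Z j (Y j *m Xrun R n j t *m Y (j + t + 1)).
Proof.
move=> tn; apply: anti_comm_Z; last by rewrite -addnA addn1; apply: comm_Z_Y.
by apply: anti_comm_Z; [exact: anti_Z_Y | apply: comm_Z_Xrun; exact: ltnW].
Qed.

(** The test operator sits at j + 1, where it meets the first [X] of the run; [Z j] would commute
    with the whole string. *)
Lemma anti_Z_ZXZ j t : (t.+1 < n)%N ->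
  anti_Z j.+1 (Z j *m Xrun R n j t.+1 *m Z (j + t.+1 + 1)).
Proof.
move=> tn; apply: anti_comm_Z; last exact: comm_Z_Z.
apply: comm_anti_Z; first exact: comm_Z_Z.
rewrite Xrun_prod runS; apply: anti_comm_Z; first exact: anti_Z_X.
by apply: comm_Z_Xrun; exact: ltnW.
Qed.

Lemma anti_Z_Xprod j : anti_Z j (\big[mulmx/1%:M]_(l < n.-1) X (j + l)%N).
Proof.
rewrite -[X in anti_Z _ X]/(\prod_(l < m.+2) X (j + l)%N : Mx) runS.
by apply: anti_comm_Z; [exact: anti_Z_X | exact: comm_Z_Xrun].
Qed.

Lemma pZ_row0 : exists i0 : 'I_(2 ^ n), forall j c,
  (Z j i0 c = (c == i0)%:R) /\ (Z j c i0 = (c == i0)%:R).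
Proof.
have [i0 H] := tensor_basis0 R n; exists i0 => j c.
have [rowE colE] := H (fun l => if l == (j %% n)%N then sigmaZ R else 1%:M).
split; [apply: rowE|apply: colE] => l {}c; case: eqP => _; rewrite !mxE //.
- by case: c => -[|[|//]] ?.
- by rewrite eq_sym.
- by case: c => -[|[|//]] ?.
Qed.

Section Diag.
Variable i0 : 'I_(2 ^ n).
Hypothesis Zi0 : forall j c, (Z j i0 c = (c == i0)%:R) /\ (Z j c i0 = (c == i0)%:R).

Lemma pZ_mul_diag j (M : Mx) : (Z j *m M) i0 i0 = M i0 i0.
Proof.
rewrite mxE (bigD1 i0) //= (Zi0 j i0).1 eqxx mul1r big1 ?addr0 // => c /negPf ci.
by rewrite (Zi0 j c).1 ci mul0r.
Qed.

Lemma mul_pZ_diag j (M : Mx) : (M *m Z j) i0 i0 = M i0 i0.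
Proof.
rewrite mxE (bigD1 i0) //= (Zi0 j i0).2 eqxx mulr1 big1 ?addr0 // => c /negPf ci.
by rewrite (Zi0 j c).2 ci mulr0.
Qed.

(** [Z j] fixes the basis vector at [i0] from both sides, so Z M and M Z have the same diagonal
    entry there as M, which is therefore its own opposite. *)
Lemma anti_Z_diag j (M : Mx) : anti_Z j M -> M i0 i0 = 0.
Proof.
move=> aM; have /eqP : M i0 i0 = - M i0 i0.
  by rewrite -{1}(pZ_mul_diag j) aM mxE mul_pZ_diag.
by rewrite -addr_eq0 -mulr2n mulrn_eq0 => /eqP.
Qed.

Lemma diag_sum0 (a : C) (F : nat -> Mx) : (forall j, F j i0 i0 = 0) ->
  (a *: \sum_(j < n) F j) i0 i0 = 0.
Proof. by move=> F0; rewrite mxE summxE big1 ?mulr0 // => j _. Qed.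

Lemma diag_symX : symX R n i0 i0 = 0.
Proof. by apply: (@diag_sum0 _ (fun j => X j)) => j; exact: anti_Z_diag (anti_Z_X j). Qed.

Lemma diag_symXn1 : symXn1 R n i0 i0 = 0.
Proof.
apply: (@diag_sum0 _ (fun j => \big[mulmx/1%:M]_(l < n.-1) X (j + l)%N)) => j.
exact: anti_Z_diag (anti_Z_Xprod j).
Qed.

Lemma diag_symYXY t : (t.+1 < n)%N -> symYXY R n t i0 i0 = 0.
Proof.
move=> tn; apply: (@diag_sum0 _ (fun j => Y j *m Xrun R n j t *m Y (j + t + 1)%N)) => j.
exact: anti_Z_diag (anti_Z_YXY j tn).
Qed.

Lemma diag_symZXZ t : (t.+1 < n)%N -> symZXZ R n t.+1 i0 i0 = 0.
Proof.
move=> tn; apply: (@diag_sum0 _ (fun j => Z j *m Xrun R n j t.+1 *m Z (j + t.+1 + 1)%N)) => j.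
exact: anti_Z_diag (anti_Z_ZXZ j tn).
Qed.

Lemma diag_symZZ : symZXZ R n 0 i0 i0 = Num.imaginary * n%:R.
Proof.
rewrite /symZXZ mxE ?complexiE summxE; congr (_ * _).
rewrite (eq_bigr (fun _ => 1)) ?sumr_const ?card_ord // => j _.
by rewrite mul_pZ_diag pZ_mul_diag /Xrun big_geq // mxE eqxx.
Qed.

Lemma diag_comb2 (a b : C) (M M' : Mx) : M i0 i0 = 0 -> M' i0 i0 = 0 ->
  (a *: M + b *: M') i0 i0 = 0.
Proof. by move=> E E'; rewrite !mxE E E' !mulr0 addr0. Qed.

Lemma diag_comb4 (a b c d : C) (M1 M2 M3 M4 S : Mx) : M1 i0 i0 = 0 -> M2 i0 i0 = 0 ->
  M3 i0 i0 = 0 -> S i0 i0 = 0 ->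
  (d *: (a *: M1 + b *: M2 + c *: M3 + M4) + d *: S) i0 i0 = d * M4 i0 i0.
Proof. by move=> E1 E2 E3 ES; rewrite !mxE E1 E2 E3 ES !mulr0 !add0r addr0. Qed.

(** ZZ enters [tY] with coefficient 1 whatever k is, so the entry is i/2 for every k. *)
Lemma diag_tY k : tY R n k i0 i0 = (2 * n%:R)^-1 * (Num.imaginary * n%:R).
Proof.
have mn : ((n - 2).+1 < n)%N by rewrite subn2.
rewrite -diag_symZZ; apply: diag_comb4.
- exact: diag_symX.
- exact: diag_symYXY.
- exact: diag_symXn1.
rewrite summxE big_nat_cond big1 // => -[|j] /andP[/andP[j0 jm] _] //.
have jn : (j.+1 < n)%N by rewrite ltnW.
by apply: diag_comb2; [exact: diag_symYXY | exact: diag_symZXZ].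
Qed.

End Diag.

Lemma tY_neq0 k : tY R n k <> 0.
Proof.
have [i0 Zi0] := pZ_row0; move=> /matrixP/(_ i0 i0)/eqP.
rewrite (diag_tY Zi0) mxE !mulf_eq0 invr_eq0 mulf_eq0 !pnatr_eq0.
by rewrite (negPf (neq0Ci _)).
Qed.

End NonVanishing.

(* k : 'I_n.-1 stands for the index k.+1 in 1, ..., n - 1. *)
Theorem theorem4 (R : realType) (n : nat) (hn : (3 <= n)%N) :
  exists gk : 'I_n.-1 -> set 'M[R[i]]_(2 ^ n),
    [/\ forall k, [/\ lie_ideal (gk k) (gCn R n), simple_lie (gk k)
                    & lie_isomorphic (gk k) (su R 2)],
        is_direct_sum (gCn R n)
          (fun o : option 'I_n.-1 =>
             if o is Some k then gk k else lie_center (gCn R n)),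
        is_direct_sum (derived_algebra (gCn R n)) gk,
        forall k, [/\ gk k (tX R n k.+1), gk k (tY R n k.+1)
                    & gk k (tZ R n k.+1)]
      & canonical_basis gk (fun k => tX R n k.+1) (fun k => tY R n k.+1)
          (fun k => tZ R n k.+1)].
Proof.
case: n hn => [|[|[|m]]] // _; set n := m.+3.
have n_gt0 : (0 < n)%N by [].
(* The generators are X = - A_0 and ZZ = A_1; [gCn] writes the latter without the empty run that
   [symZXZ] contains. *)
have gE : gCn R n = onsager (@onsA R n).
  rewrite /gCn /onsager -(symX_ons R n_gt0); congr (lie_generated [set _; _]).
  transitivity (symZXZ R n 0); last by rewrite (symZXZ_ons R n_gt0).
  rewrite /symZXZ; congr (_ *: _); apply: eq_bigr => j _.
  have -> : Xrun R n j 0 = 1%:M by rewrite /Xrun big_geq.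
  by rewrite mulmx1 addn0.
have XE : (fun k : 'I_n.-1 => tX R n k.+1) = fun k => modeX (@onsA R n) (mode k).
  by apply/funext => k; rewrite tX_mode.
have YE : (fun k : 'I_n.-1 => tY R n k.+1) = fun k => modeY (@onsA R n) (mode k).
  by apply/funext => k; rewrite tY_mode.
have ZE : (fun k : 'I_n.-1 => tZ R n k.+1) = fun k => modeZ (@onsG R n) (mode k).
  by apply/funext => k; rewrite tZ_mode.
have Y0 (k : 'I_n.-1) : modeY (@onsA R n) (mode k) <> 0.
  by rewrite -[modeY _ _]/((fun k => modeY (@onsA R n) (mode k)) k) -YE; exact: tY_neq0.
have [H1 H2 H3 H4 H5] := onsager_structure n_gt0 (bracket_onsAA R n_gt0)
  (bracket_onsAG R n_gt0) (onsG_N R n_gt0) Y0.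
exists (simple_part (@onsA R n) (@onsG R n)); rewrite gE XE YE ZE; split.
- exact: H1.
- exact: H2.
- exact: H3.
- by move=> k; rewrite tX_mode tY_mode tZ_mode; exact: H4.
- exact: H5.
Qed.
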